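(* Let $G=\mathrm{GL}_n(\mathbb C)$ and let $\theta(g)=J\,{}^tg^{-1}J^{-1}$ be an involution of $G$, where $J\in\mathrm{GL}_n(\mathbb C)$ satisfies $J^2=\mathbf 1_n$. Let $K=G^\theta$, let $P\subset G$ and $Q\subset K$ be parabolic subgroups, and let $P_3\subset G$ be a $\theta$-stable parabolic subgroup with $Q=P_3\cap K$. Consider the double flag variety $\mathfrak X=K/Q\times G/P$ with diagonal $K$-action, the triple flag variety $\mathbb X=G/P_3\times\bigl(G/P\times G/\theta(P)\bigr)$ with diagonal $G$-action, and the $K$-equivariant embedding $$\mathfrak X\hookrightarrow\mathbb X,\qquad (kQ,gP)\mapsto\bigl(kP_3,\ gP,\ \theta(g)\theta(P)\bigr).$$ Then the induced map on orbits $\mathfrak X/K\to\mathbb X/G$, $\mathcal O\mapsto G\cdot\mathcal O$, is injective. In particular, if the triple flag variety $\mathbb X$ is of finite type (has finitely many $G$-orbits), then the double flag variety $\mathfrak X$ is of finite type (has finitely many $K$-orbits).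
   Context: Standing assumption: the symmetric subgroup $K=G^\theta$ is connected. $\mathfrak X/K$ and $\mathbb X/G$ denote the sets of orbits. *)

(* Defs.v *)
From HB Require Import structures.
From mathcomp Require Import all_boot all_order all_algebra.
From mathcomp Require Import boolp classical_sets functions cardinality reals.
From mathcomp Require Import topology_structure connected.
From mathcomp Require Import complex.
(* The notations of mpoly clash with those of mathcomp-analysis. *)
From mathcomp Require Import -(notations) mpoly.

Set Implicit Arguments.
Unset Strict Implicit.
Unset Printing Implicit Defensive.

Import GRing.Theory.
Local Open Scope classical_set_scope.
Local Open Scope ring_scope.

(* Subgroups of GL_n(F) are sets of n x n matrices. [zariski F n] is a copy of
   'M[F]_n that carries the Zariski topology of affine n^2-space. *)
Definition zariski (F : fieldType) (n : nat) : Type := 'M[F]_n.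

HB.instance Definition _ (F : fieldType) (n : nat) :=
  Choice.copy (zariski F n) 'M[F]_n.

Section ZariskiTopology.
Variables (F : fieldType) (n : nat).
Implicit Types (S : set (mpoly (n * n) F)) (A U : set (zariski F n)).

Definition entry_eval (p : mpoly (n * n) F) (g : zariski F n) : F :=
  meval (fun k => mxvec (g : 'M[F]_n) 0 k) p.

Definition zero_locus S : set (zariski F n) :=
  [set g | forall p, S p -> entry_eval p g = 0].

Definition zariski_open U := exists S, U = ~` zero_locus S.

Let zariski_openT : zariski_open setT.
Proof.
exists [set 1]; apply/esym; rewrite -subTset => g _ /(_ 1 erefl)/eqP.
by rewrite /entry_eval meval1 oner_eq0.
Qed.

Let zariski_openI : setI_closed zariski_open.
Proof.
move=> _ _ [S ->] [S' ->].
exists [set p * q | p in S & q in S']; rewrite -setCU; congr (~` _).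
apply/seteqP; split=> g.
  move=> H _ [p Sp] [q Sq] <-; rewrite /entry_eval mevalM.
  case: H => [/(_ p Sp)|/(_ q Sq)]; rewrite /entry_eval => ->.
    by rewrite mul0r.
  by rewrite mulr0.
move=> H; apply: contrapT => /not_orP[/existsNP[p /not_implyP[Sp p0]]].
move=> /existsNP[q /not_implyP[Sq q0]].
have : entry_eval (p * q) g = 0 by apply: H; exists p => //; exists q.
by rewrite /entry_eval mevalM => /eqP; rewrite mulf_eq0 => /orP[]/eqP.
Qed.

Let zariski_open_bigU (I : Type) (f : I -> set (zariski F n)) :
  (forall i, zariski_open (f i)) -> zariski_open (\bigcup_i f i).
Proof.
move=> /choice[S fS]; exists (\bigcup_i S i).
rewrite (_ : zero_locus _ = \bigcap_i zero_locus (S i)).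
  by rewrite setC_bigcap; apply: eq_bigcup => // i _; rewrite fS.
apply/seteqP; split=> [g H i _ p Sp|g H p [i _ Sp]]; last exact: (H i).
by apply: H; exists i.
Qed.

HB.instance Definition _ := isOpenTopological.Build (zariski F n)
  zariski_openT zariski_openI zariski_open_bigU.

Lemma zariski_closedP A : closed A <-> exists S, A = zero_locus S.
Proof.
rewrite -openC; split=> -[S AS]; exists S; last by rewrite AS.
by rewrite -[A]setCK AS setCK.
Qed.

End ZariskiTopology.

Section LinearAlgebraicGroups.
Variables (F : fieldType) (n : nat).
Implicit Types (g h : 'M[F]_n) (B G H P Q S : set 'M[F]_n).

Definition GL : set 'M[F]_n := [set g | g \in unitmx].

Definition is_subgroup H : Prop :=
  [/\ H `<=` GL,
      H 1%:M,
      forall g h, H g -> H h -> H (g *m h) &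
      forall g, H g -> H (invmx g)].

Definition zariski_closed H : Prop :=
  exists2 Z : set (zariski F n), closed Z & H = GL `&` Z.

Definition zariski_connected H : Prop := @connected (zariski F n) H.

Definition mxcommutator g h : 'M[F]_n := g *m h *m invmx g *m invmx h.

Definition derived_subgroup H : set 'M[F]_n :=
  smallest is_subgroup [set mxcommutator g h | g in H & h in H].

Definition solvable_subgroup H : Prop :=
  exists k : nat, iter k derived_subgroup H = [set 1%:M].

Definition closed_connected_solvable G B : Prop :=
  [/\ is_subgroup B, B `<=` G, zariski_closed B, zariski_connected B
    & solvable_subgroup B].

Definition borel_subgroup G B : Prop :=
  closed_connected_solvable G B /\
  forall B', closed_connected_solvable G B' -> B `<=` B' -> B' = B.

Definition parabolic_subgroup G P : Prop :=
  [/\ is_subgroup P, P `<=` G, zariski_closed P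
    & exists2 B, borel_subgroup G B & B `<=` P].

Definition ltrans g S : set 'M[F]_n := [set g *m s | s in S].

Definition left_cosets G P : set (set 'M[F]_n) := [set ltrans g P | g in G].

Definition group_orbit (T : Type) G (act : 'M[F]_n -> T -> T) (x : T) : set T :=
  [set act g x | g in G].

Definition group_orbits (T : Type) G (act : 'M[F]_n -> T -> T) (X : set T) :
  set (set T) := [set group_orbit G act x | x in X].

End LinearAlgebraicGroups.

Arguments GL {F n}.

Section FlagVarieties.
Variables (F : fieldType) (n : nat) (J : 'M[F]_n).
Implicit Types (g h : 'M[F]_n) (P Q S : set 'M[F]_n).

Definition theta g : 'M[F]_n := J *m (invmx g)^T *m invmx J.

Definition fixed_subgroup : set 'M[F]_n := [set g | GL g /\ theta g = g].

Definition double_flag Q P : set (set 'M[F]_n * set 'M[F]_n) :=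
  left_cosets fixed_subgroup Q `*` left_cosets GL P.

Definition triple_flag (P3 : set 'M[F]_n) P :
    set (set 'M[F]_n * (set 'M[F]_n * set 'M[F]_n)) :=
  left_cosets GL P3 `*` (left_cosets GL P `*` left_cosets GL (theta @` P)).

Definition double_act h (x : set 'M[F]_n * set 'M[F]_n) :=
  (ltrans h x.1, ltrans h x.2).

Definition triple_act h (x : set 'M[F]_n * (set 'M[F]_n * set 'M[F]_n)) :=
  (ltrans h x.1, (ltrans h x.2.1, ltrans h x.2.2)).

(* Written without coset representatives; [flag_embE] gives the formula
   (kQ, gP) |-> (k P3, gP, theta(g) theta(P)). *)
Definition flag_emb (P3 : set 'M[F]_n) (x : set 'M[F]_n * set 'M[F]_n) :
    set 'M[F]_n * (set 'M[F]_n * set 'M[F]_n) :=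
  ([set s *m p | s in x.1 & p in P3], (x.2, theta @` x.2)).

(* O |-> G.O, where O is viewed inside the triple flag variety. *)
Definition orbit_map (P3 : set 'M[F]_n)
    (O : set (set 'M[F]_n * set 'M[F]_n)) :
    set (set 'M[F]_n * (set 'M[F]_n * set 'M[F]_n)) :=
  [set triple_act g y | g in GL & y in flag_emb P3 @` O].

Lemma invmxM g h : GL g -> GL h -> invmx (g *m h) = invmx h *m invmx g.
Proof.
rewrite /GL /= => ug uh; have ugh : g *m h \in unitmx by rewrite unitmx_mul ug.
apply: (can_inj (mulKmx ugh)); rewrite mulmxV //.
by rewrite mulmxA -(mulmxA g) mulmxV // mulmx1 mulmxV.
Qed.

Lemma thetaM g h : J \in unitmx -> GL g -> GL h ->
  theta (g *m h) = theta g *m theta h.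
Proof.
move=> uJ ug uh; rewrite /theta invmxM // trmx_mul !mulmxA.
by congr (_ *m _ *m _); rewrite -!mulmxA mulVmx // mulmx1.
Qed.

Lemma flag_embE Q P P3 k g : J \in unitmx -> is_subgroup P -> is_subgroup P3 ->
    Q 1%:M -> Q `<=` P3 -> GL g ->
  flag_emb P3 (ltrans k Q, ltrans g P) =
    (ltrans k P3, (ltrans g P, ltrans (theta g) (theta @` P))).
Proof.
move=> uJ [PGL _ _ _] [_ _ P3M _] Q1 QP3 ug; congr (_, (_, _)).
  apply/seteqP; split=> x.
    move=> [_ [q Qq <-]] [p P3p <-]; exists (q *m p); last by rewrite mulmxA.
    by apply: P3M => //; exact: QP3.
  move=> [p P3p <-]; exists k; first by exists 1%:M => //; rewrite mulmx1.
  by exists p.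
apply/seteqP; split=> x.
  move=> [_ [p Pp <-] <-]; exists (theta p); first by exists p.
  by rewrite thetaM //; exact: PGL.
move=> [_ [p Pp <-] <-]; exists (g *m p); first by exists p.
by rewrite thetaM //; exact: PGL.
Qed.

Lemma flag_emb_equivariant Q P P3 h x : J \in unitmx -> P `<=` GL ->
    fixed_subgroup h -> double_flag Q P x ->
  flag_emb P3 (double_act h x) = triple_act h (flag_emb P3 x).
Proof.
case: x => S T uJ PGL [uh fh] [_ [g ug /= gT]].
congr (_, (_, _)); apply/seteqP; split=> y /=.
- move=> [_ [s Ss <-]] [p P3p <-]; exists (s *m p); last by rewrite mulmxA.
  by exists s => //; exists p.
- move=> [_ [s Ss [p P3p <-]] <-]; exists (h *m s); first by exists s.
  by exists p => //; rewrite mulmxA.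
- move=> [_ [t Tt <-] <-]; exists (theta t); first by exists t.
  rewrite thetaM ?fh //; move: Tt; rewrite -gT => -[p Pp <-].
  by rewrite /GL /= unitmx_mul; apply/andP; split => //; exact: PGL.
- move=> [_ [t Tt <-] <-]; exists (h *m t); first by exists t.
  rewrite thetaM ?fh //; move: Tt; rewrite -gT => -[p Pp <-].
  by rewrite /GL /= unitmx_mul; apply/andP; split => //; exact: PGL.
Qed.

Lemma fixed_subgroupM g h : J \in unitmx ->
  fixed_subgroup g -> fixed_subgroup h -> fixed_subgroup (g *m h).
Proof.
move=> uJ [ug gE] [uh hE]; split; last by rewrite thetaM // gE hE.
by rewrite /GL /= unitmx_mul; apply/andP.
Qed.

Lemma fixed_subgroupV g : J \in unitmx ->
  fixed_subgroup g -> fixed_subgroup (invmx g).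
Proof.
move=> uJ [ug gE]; have ug' : GL (invmx g) by rewrite /GL /= unitmx_inv.
split=> //; rewrite -[RHS]mul1mx -[LHS]mulmx1 -(mulmxV ug) mulmxA.
congr (_ *m _); rewrite -[in X in _ *m X]gE -thetaM // mulVmx //.
by rewrite mulmxV // /theta invmx1 trmx1 mulmx1 mulmxV.
Qed.

Lemma flag_emb_inj Q P P3 : J \in unitmx -> is_subgroup P3 ->
  Q = P3 `&` fixed_subgroup -> set_inj (double_flag Q P) (flag_emb P3).
Proof.
move=> uJ [P3GL P31 P3M P3V] QE.
have recover S : left_cosets fixed_subgroup Q S ->
    S = [set s *m p | s in S & p in P3] `&` fixed_subgroup.
  move=> [k Kk <-]; apply/seteqP; split=> x.
    move=> [q]; rewrite QE => -[P3q Kq] <-; split; last exact: fixed_subgroupM.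
    exists (k *m q); first by exists q.
    by exists 1%:M => //; rewrite mulmx1.
  move=> [[_ [q + <-] [p P3p <-]]]; rewrite QE => -[P3q Kq] Kx.
  exists (q *m p); last by rewrite mulmxA.
  split; first exact: P3M.
  have -> : q *m p = invmx k *m (k *m q *m p).
    by rewrite -mulmxA mulKmx //; case: Kk.
  by apply: fixed_subgroupM => //; exact: fixed_subgroupV.
move=> [S T] [S' T']; rewrite !inE => -[/= /recover SE _] [/= /recover S'E _].
by move=> [SS' <- _]; rewrite SE SS' -S'E.
Qed.

End FlagVarieties.

(* Main.v *)
Require Import Defs.
From mathcomp Require Import all_boot all_order all_algebra.
From mathcomp Require Import boolp classical_sets functions cardinality reals.
From mathcomp Require Import topology_structure connected.
From mathcomp Require Import complex.
From mathcomp Require Import -(notations) mpoly.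
From mathcomp Require Import ring.

(** Two points of the double flag variety whose images lie in one [G]-orbit may be
    moved by [K] to [(Q, g1 P)] and [(Q, g2 P)].  An element [h] of [G] relating the
    images lies in [P3], and both [h] and [theta(h)] carry [g1 P] to [g2 P].  Then
    [a = theta(h)^-1 h] lies in [P3] and in the stabilizer [g1 P g1^-1] of [g1 P], and
    [theta(a) = a^-1].  Over the complex numbers there is a polynomial [p = f(a)] in
    [a] with [a p^2 = 1] (lemma [inv_sqrt_mx]).  Since
    [theta(x)^-1 = J x^T J^-1] is a linear anti-automorphism fixing [a], it fixes
    [p], and so [k = h p] is fixed by [theta].  A parabolic subgroup of GL_n contains
    the invertible polynomials in its elements ([parabolic_horner]); hence [p] lies
    in [P3] and stabilizes [g1 P], and the element [k] of [Q] carries [g1 P] to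
    [g2 P].  This is [fixed_representative].

    The substance is [parabolic_horner], as parabolic subgroups are defined by
    containing a maximal closed connected solvable subgroup.  Such a subgroup is the
    stabilizer of a complete flag ([borel_subgroup_trig]): by the Lie-Kolchin theorem
    ([lie_kolchin]) it stabilizes a complete flag, and the whole stabilizer of a flag
    is again closed, connected and solvable.  If a group [P] contains the triangular
    group, then the [P]-orbit of the first basis line is the set of all lines of a
    [P]-stable subspace, in which any [a] in [P] has an eigenvector; by induction
    on the dimension, [a] is conjugate in [P] to a triangular matrix
    ([conj_into_triangular]).  Triangular matrices form an algebra, so polynomials
    in [a] stay in [P]. *)

Import GRing.Theory Num.Theory.
Local Open Scope classical_set_scope.
Local Open Scope ring_scope.
Set Implicit Arguments.
Unset Strict Implicit.
Unset Printing Implicit Defensive.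

(** * Inverse square roots as polynomials *)

Section PolynomialSquareRoot.
Variable F : numClosedFieldType.

Lemma quadratic_root (a b c : F) : (a != 0) || (b != 0) ->
  exists x, a * x ^+ 2 + b * x + c = 0.
Proof.
have [-> /= b0|a0 _] := eqVneq a 0.
  by exists (- c / b); rewrite mul0r add0r mulrC divfK ?addNr.
pose d := sqrtC (b ^+ 2 - 4%:R * a * c).
have dE : d ^+ 2 = b ^+ 2 - 4%:R * a * c by rewrite sqrtCK.
exists ((d - b) / (2%:R * a)).
have a4 : 4%:R * a != 0 by rewrite mulf_neq0 ?pnatr_eq0.
apply: (mulfI a4); rewrite mulr0.
transitivity (d ^+ 2 - (b ^+ 2 - 4%:R * a * c)); last by rewrite dE subrr.
by field.
Qed.

(** Induction on the roots: to pass from [chi] to [('X - r%:P) * chi], correct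
    [f] by a multiple [c] of [chi].  The condition on [c] is an equation of degree
    at most two; its nonconstant coefficients cannot both vanish, since at a root
    [r] of [chi] the induction hypothesis makes [r * f.[r] ^+ 2] equal to 1. *)
Lemma inv_sqrt_modp (rs : seq F) : 0 \notin rs ->
  exists f, \prod_(r <- rs) ('X - r%:P) %| 'X * f ^+ 2 - 1.
Proof.
elim: rs => [|r rs IH]; first by exists 0; rewrite big_nil dvd1p.
rewrite inE negb_or eq_sym => /andP[r0 /IH[f /dvdpP[q qE]]].
rewrite big_cons; set chi := \prod_(_ <- _) _ in qE *.
have [c cE] : exists c,
    r * chi.[r] * c ^+ 2 + (2%:R * r * f.[r]) * c + q.[r] = 0.
  apply: quadratic_root; rewrite mulf_eq0 (negPf r0) /=.
  have [chi0|//] := eqVneq chi.[r] 0.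
  rewrite /= !mulf_neq0 ?pnatr_eq0 //; apply/eqP => f0.
  move/(congr1 (fun p => p.[r]))/eqP: qE.
  by rewrite !hornerE f0 chi0 mulr0 /= mulr0 sub0r oppr_eq0 oner_eq0.
exists (f + c%:P * chi).
have -> : 'X * (f + c%:P * chi) ^+ 2 - 1 =
    ('X * chi * c%:P ^+ 2 + ('X * f * c%:P) *+ 2 + q) * chi.
  by rewrite mulrDl -qE; ring.
rewrite dvdp_mul // dvdp_XsubCl rootE !hornerE.
by rewrite /=; apply/eqP; rewrite -[RHS]cE; ring.
Qed.

(** By Cayley-Hamilton it is enough to invert and take a root modulo the
    characteristic polynomial, whose roots are nonzero. *)
Lemma inv_sqrt_mx n (a : 'M[F]_n.+1) : a \in unitmx ->
  exists f, a *m (horner_mx a f *m horner_mx a f) = 1%:M.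
Proof.
move=> ua; have [rs rsE] := closed_field_poly_normal (char_poly a).
have [f /dvdpP[q qE]] : exists f, char_poly a %| 'X * f ^+ 2 - 1.
  rewrite rsE (monicP (char_poly_monic _)) scale1r.
  apply: inv_sqrt_modp; apply: contraL ua => rs0.
  have : root (char_poly a) 0.
    by rewrite rsE (monicP (char_poly_monic _)) scale1r root_prod_XsubC.
  rewrite rootE horner_coef0 char_poly_det mulf_eq0 signr_eq0 /=.
  by rewrite unitmxE unitfE negbK.
exists f; apply/eqP; rewrite -subr_eq0.
have <- : horner_mx a ('X * f ^+ 2 - 1) = a *m (horner_mx a f *m horner_mx a f) - 1%:M.
  by rewrite rmorphB rmorphM rmorphXn rmorph1 /= horner_mx_X expr2.
by rewrite qE rmorphM /= Cayley_Hamilton mulr0.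
Qed.

Lemma invmx_horner n (a : 'M[F]_n.+1) : a \in unitmx ->
  exists f, invmx a = horner_mx a f.
Proof.
move=> ua; have [f fE] := inv_sqrt_mx ua; exists (f ^+ 2).
by apply: (can_inj (mulKmx ua)); rewrite mulmxV // rmorphXn.
Qed.

End PolynomialSquareRoot.
(** * Regular functions and connectedness in the Zariski topology *)

Section RegularFunctions.
Variables (F : fieldType) (n : nat).
Implicit Types (f : 'M[F]_n -> F) (g h : 'M[F]_n) (G H : set 'M[F]_n).

(** The coordinate ring of GL_n: polynomials in the entries with a power of the
    determinant as denominator.  Nothing is asked of [f] at singular matrices. *)
Definition regular f := exists k (p : mpoly (n * n) F),
  forall g, GL g -> f g * \det g ^+ k = entry_eval p g.

Definition generic_mx : 'M[mpoly (n * n) F]_n :=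
  \matrix_(i, j) mpolyX F (mnm1 (mxvec_index i j)).

Lemma eval_generic_mx g :
  map_mx (meval (fun k => mxvec g 0 k)) generic_mx = g.
Proof. by apply/matrixP => i j; rewrite !mxE mevalXU mxvecE. Qed.

Lemma entry_eval_det g : entry_eval (\det generic_mx) g = \det g.
Proof. by rewrite -{2}[g]eval_generic_mx det_map_mx. Qed.

Lemma regular_ext f f' : (forall g, GL g -> f g = f' g) -> regular f -> regular f'.
Proof. by move=> ff' [k [p fp]]; exists k, p => g ug; rewrite -ff' ?fp. Qed.

Lemma regular_cst c : regular (fun=> c).
Proof. by exists 0%N, (mpolyC _ c) => g _; rewrite expr0 mulr1 /entry_eval mevalC. Qed.

Lemma regular_entry i j : regular (fun g => g i j).
Proof.
exists 0%N, (mpolyX F (mnm1 (mxvec_index i j))) => g _.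
by rewrite expr0 mulr1 /entry_eval mevalXU mxvecE.
Qed.

Lemma regular_inv_entry i j : regular (fun g => invmx g i j).
Proof.
exists 1%N, ((\adj generic_mx) i j) => g; rewrite /GL /= => ug.
rewrite /entry_eval; transitivity ((\adj g) i j).
  by rewrite /invmx ug mxE mulrC expr1 mulVKf // -unitfE -unitmxE.
by rewrite -{1}[g]eval_generic_mx -map_mx_adj mxE.
Qed.

Lemma regularD f f' : regular f -> regular f' -> regular (fun g => f g + f' g).
Proof.
move=> [k [p fp]] [k' [p' fp']]; set d := \det generic_mx.
exists (k + k')%N, (p * d ^+ k' + p' * d ^+ k) => g ug.
rewrite /entry_eval mevalD !mevalM !rmorphXn /= -!/(entry_eval _ g) entry_eval_det.
by rewrite -fp // -fp' // exprD; ring.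
Qed.

Lemma regularM f f' : regular f -> regular f' -> regular (fun g => f g * f' g).
Proof.
move=> [k [p fp]] [k' [p' fp']]; exists (k + k')%N, (p * p') => g ug.
by rewrite /entry_eval mevalM -!/(entry_eval _ g) -fp // -fp' // exprD; ring.
Qed.

Lemma regular_sum (I : Type) (r : seq I) (f : I -> 'M[F]_n -> F) :
  (forall i, regular (f i)) -> regular (fun g => \sum_(i <- r) f i g).
Proof.
move=> rf; elim: r => [|i r IH].
  by apply: (@regular_ext (fun=> 0)); [move=> g _; rewrite big_nil|exact: regular_cst].
apply: (@regular_ext (fun g => f i g + \sum_(i <- r) f i g)).
  by move=> g _; rewrite big_cons.
exact: regularD.
Qed.

Lemma regular_prod (I : Type) (r : seq I) (f : I -> 'M[F]_n -> F) :
  (forall i, regular (f i)) -> regular (fun g => \prod_(i <- r) f i g).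
Proof.
move=> rf; elim: r => [|i r IH].
  by apply: (@regular_ext (fun=> 1)); [move=> g _; rewrite big_nil|exact: regular_cst].
apply: (@regular_ext (fun g => f i g * \prod_(i <- r) f i g)).
  by move=> g _; rewrite big_cons.
exact: regularM.
Qed.

Definition regular_mx p q (rho : 'M[F]_n -> 'M[F]_(p, q)) :=
  forall i j, regular (fun g => rho g i j).

Lemma regular_mx_id : regular_mx id.
Proof. exact: regular_entry. Qed.

Lemma regular_mx_inv : regular_mx invmx.
Proof. exact: regular_inv_entry. Qed.

Lemma regular_mx_cst p q (A : 'M[F]_(p, q)) : regular_mx (fun=> A).
Proof. by move=> i j; exact: regular_cst. Qed.

Lemma regular_mxM p q r (rho : 'M[F]_n -> 'M[F]_(p, q)) (sg : 'M[F]_n -> 'M[F]_(q, r)) :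
  regular_mx rho -> regular_mx sg -> regular_mx (fun g => rho g *m sg g).
Proof.
move=> rrho rsg i j; apply: (@regular_ext (fun g => \sum_k rho g i k * sg g k j)).
  by move=> g _; rewrite mxE.
by apply: regular_sum => k; exact: regularM.
Qed.

Lemma regular_comp (p : mpoly (n * n) F) (phi : 'M[F]_n -> 'M[F]_n) :
  regular_mx phi -> regular (fun g => entry_eval p (phi g)).
Proof.
move=> rphi; apply: (@regular_ext (fun g => \sum_(m <- msupp p)
    mcoeff m p * \prod_k mxvec (phi g) 0 k ^+ m k)).
  by move=> g _; rewrite /entry_eval mevalE.
apply: regular_sum => m; apply: regularM; first exact: regular_cst.
apply: regular_prod => k; case/mxvec_indexP: k => i j.
apply: (@regular_ext (fun g => \prod_(t <- nseq (m (mxvec_index i j)) tt) phi g i j)).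
  by move=> g _; rewrite mxvecE big_nseq iter_mulr_1.
by apply: regular_prod.
Qed.

(** Where the determinant does not vanish, the denominators of regular functions
    are harmless. *)
Lemma regular_zero_closed (I : Type) (f : I -> 'M[F]_n -> F) :
  (forall i, regular (f i)) ->
  exists2 Z : set (zariski F n), closed Z &
    GL `&` [set g | forall i, f i g = 0] = GL `&` Z.
Proof.
move=> /choice[k /choice[p fp]]; exists (zero_locus (range p)).
  by apply/zariski_closedP; exists (range p).
apply/seteqP; split=> g [ug] /= f0; split=> //.
  by move=> _ [i _ <-]; rewrite -fp // f0 mul0r.
move=> i; have /eqP := f0 (p i) (imageT p i).
rewrite -fp // mulf_eq0 => /orP[/eqP //|]; rewrite expf_eq0 => /andP[_].
by move: ug; rewrite /GL /= unitmxE unitfE => /negP.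
Qed.

(** Precomposition with a regular map turns polynomials into regular functions, so
    traces of closed sets pull back to traces of closed sets. *)
Lemma connected_regular_image G (phi : 'M[F]_n -> 'M[F]_n) :
  G `<=` GL -> regular_mx phi -> zariski_connected G ->
  zariski_connected (phi @` G).
Proof.
move=> GGL rphi cG.
have pre (C : set (zariski F n)) : closed C ->
    exists2 Z : set (zariski F n), closed Z &
      G `&` [set g | C (phi g)] = G `&` Z.
  move=> /zariski_closedP[S ->].
  have [|Z cZ ZE] := @regular_zero_closed {p | S p}
    (fun p g => entry_eval (sval p) (phi g)).
    by move=> [p Sp]; exact: regular_comp.
  exists Z => //; rewrite -[G](setIidl GGL) -!setIA -ZE.
  congr (_ `&` (_ `&` _)); apply/seteqP; split=> g /=.
    by move=> Cg [p Sp]; exact: Cg.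
  by move=> Cg p Sp; exact: (Cg (exist _ p Sp)).
move=> B [b Bb] [U oU BU] [C cC BC].
have [ZC cZC ZCE] := pre _ cC.
have [ZU cZU ZUE] := pre _ (open_closedC oU).
have preE : G `&` [set g | B (phi g)] = G.
  apply: cG.
  - have [[g Gg gb] _] : (phi @` G `&` C) b by rewrite -BC.
    by exists g; split=> //=; rewrite gb.
  - exists (~` ZU); first exact: closed_openC.
    apply/seteqP; split=> g [Gg] /=; rewrite BU.
      move=> [_ Ug]; split=> // ZUg.
      by have : (G `&` ZU) g by []; rewrite -ZUE => -[].
    move=> nZ; split=> //; split; first by exists g.
    apply: contrapT => nU; apply: nZ.
    by have : (G `&` [set g | (~` U) (phi g)]) g by []; rewrite ZUE => -[].
  - exists ZC => //; rewrite -ZCE BC.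
    by apply/seteqP; split=> g [Gg] /=; [case|split=> //; split=> //; exists g].
apply/seteqP; split=> [x|_ [g Gg <-]]; first by rewrite BC => -[].
by move: Gg; rewrite -preE => -[].
Qed.

(** The fibres of a regular function with finitely many values are open as well as
    closed. *)
Lemma connected_regular_constant G f (s : seq F) :
  G `<=` GL -> zariski_connected G -> regular f ->
  (forall g, G g -> f g \in s) ->
  forall g h, G g -> G h -> f g = f h.
Proof.
move=> GGL cG rf fs g0 h0 Gg0 Gh0.
pose fibre c := [set g | GL g /\ f g - c = 0].
have /choice[Z ZP] c : exists Z : set (zariski F n),
    closed Z /\ GL `&` Z = fibre c.
  have [|Z cZ ZE] := @regular_zero_closed unit (fun _ g => f g - c).
    by move=> _; apply: regularD => //; exact: regular_cst.
  exists Z; split=> //; rewrite -ZE; apply/seteqP; split=> g [ug] /= fg; split=> //.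
  exact: (fg tt).
have inZ c g : G g -> Z c g <-> f g = c.
  move=> Gg; have ug := GGL _ Gg; split=> [Zg|fg].
    have : (GL `&` Z c) g by []. 
    by rewrite (ZP c).2 => -[_ /eqP]; rewrite subr_eq0 => /eqP.
  have : fibre c g by split=> //; rewrite fg subrr.
  by rewrite -(ZP c).2 => -[].
have BE : G `&` Z (f g0) = G.
  apply: cG.
  - by exists g0; split=> //; apply/inZ.
  - exists (~` \big[setU/set0]_(c <- [seq c <- s | c != f g0]) Z c).
      by apply: closed_openC; apply: closed_bigsetU => c _; exact: (ZP c).1.
    apply/seteqP; split=> g [Gg]; rewrite -bigcup_seq.
      move/(inZ _ _ Gg) => fg; split=> // -[c /=]; rewrite mem_filter => /andP[c0 _].
      by move/(inZ _ _ Gg) => fc; rewrite -fc fg eqxx in c0.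
    move=> nZ; split=> //; apply/inZ => //; apply/eqP/negPn/negP => fg.
    apply: nZ; exists (f g); last by apply/inZ.
    by rewrite /= mem_filter fg fs.
  - by exists (Z (f g0)) => //; exact: (ZP _).1.
by move: Gh0; rewrite -BE => -[Gh0 /(inZ _ _ Gh0)].
Qed.

End RegularFunctions.
(** * Derived subgroups *)

Section SubgroupTheory.
Variables (F : fieldType) (n : nat).
Implicit Types (g h x y : 'M[F]_n) (G H : set 'M[F]_n).

Lemma GLM g h : GL g -> GL h -> GL (g *m h).
Proof. by rewrite /GL /= unitmx_mul => -> ->. Qed.

Lemma GLV g : GL g -> GL (invmx g).
Proof. by rewrite /GL /= unitmx_inv. Qed.

Lemma derived_subgroup_sub G : is_subgroup G -> derived_subgroup G `<=` G.
Proof.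
move=> sG; apply: smallest_sub => // _ [g Gg [h Gh <-]].
by case: sG => _ _ GM GV; exact: (GM _ _ (GM _ _ (GM _ _ Gg Gh) (GV _ Gg)) (GV _ Gh)).
Qed.

Lemma commutator_derived G g h : G g -> G h -> derived_subgroup G (mxcommutator g h).
Proof. by move=> Gg Gh H [_]; apply; exists g => //; exists h. Qed.

Lemma derived_subgroup_subgroup G : is_subgroup G -> is_subgroup (derived_subgroup G).
Proof.
move=> sG; split.
- by apply: subset_trans (derived_subgroup_sub sG) _; case: sG.
- by move=> H [[]].
- move=> g h Dg Dh H HP; case: (HP) => -[_ _ HM _] _.
  by apply: HM; [exact: Dg|exact: Dh].
- by move=> g Dg H HP; case: (HP) => -[_ _ _ HV] _; apply: HV; exact: Dg.
Qed.

Lemma connected_translate g H : H `<=` GL -> zariski_connected H ->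
  zariski_connected (ltrans g H).
Proof.
move=> HGL; apply: connected_regular_image => //.
by apply: regular_mxM; [exact: regular_mx_cst|exact: regular_mx_id].
Qed.

(** The identity component of the derived subgroup is a subgroup; it contains
    every commutator, because the commutators of a fixed element form a
    connected set through the identity. *)
Lemma connected_derived_subgroup G : is_subgroup G -> zariski_connected G ->
  zariski_connected (derived_subgroup G).
Proof.
move=> sG cG; set D := derived_subgroup G.
have sD : is_subgroup D by exact: derived_subgroup_subgroup.
have [DGL D1 DM DV] := sD.
pose D0 : set 'M[F]_n := @connected_component (zariski F n) D 1%:M.
have D0D : D0 `<=` D by exact: (@connected_component_sub (zariski F n) D 1%:M).
have cD0 : zariski_connected D0 by exact: (@component_connected (zariski F n) D 1%:M).
have D01 : D0 1%:M by exact: (@connected_component_refl (zariski F n) D 1%:M).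
suff DD0 : D `<=` D0 by rewrite (_ : D = D0) //; exact/seteqP.
have translate g : D g -> ltrans g D0 `<=` D /\ zariski_connected (ltrans g D0).
  move=> Dg; split; first by move=> _ [x /D0D Dx <-]; exact: DM.
  by apply: connected_translate => // x /D0D /DGL.
apply: smallest_sub.
  split=> //; first by move=> x /D0D /DGL.
    move=> x y D0x D0y; have [xD cx] := translate x (D0D _ D0x).
    rewrite /D0 (@same_connected_component (zariski F n) D _ _ D0x).
    apply: (@connected_component_max (zariski F n) _ (ltrans x D0)) => //.
      by exists 1%:M => //; rewrite mulmx1.
    by exists y.
  move=> x D0x; have [xD cx] := translate _ (DV _ (D0D _ D0x)).
  apply: (@connected_component_max (zariski F n) _ (ltrans (invmx x) D0)) => //.
    by exists x => //; rewrite mulVmx //; exact: DGL (D0D _ D0x).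
  by exists 1%:M => //; rewrite mulmx1.
move=> _ [g Gg [h Gh <-]]; have [GGL G1 _ _] := sG.
have ug : g \in unitmx by exact: GGL.
apply: (@connected_component_max (zariski F n) _ (mxcommutator g @` G)).
- by exists 1%:M => //; rewrite /mxcommutator mulmx1 mulmxV // invmx1 mulmx1.
- by move=> _ [x Gx <-]; exact: commutator_derived.
- apply: connected_regular_image => //; rewrite /mxcommutator.
  by do ![exact: regular_mx_id|exact: regular_mx_inv|exact: regular_mx_cst
         |apply: regular_mxM].
- by exists h.
Qed.

End SubgroupTheory.

(** * Connectedness along lines *)

Section LineConnected.
Variables (F : numFieldType) (n : nat).

Lemma poly_nonroot (p : {poly F}) : p != 0 -> exists t, p.[t] != 0.
Proof.
move=> p0; apply: contrapT => /forallNP rp.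
have := max_poly_roots p0 (rs := [seq i%:R | i <- iota 0 (size p)]).
rewrite size_map size_iota ltnn => H; suff: false by [].
apply: H; first by apply/allP => t _; rewrite rootE; apply/negPn/negP; exact: rp.
by rewrite map_inj_uniq ?iota_uniq // => i j /eqP; rewrite eqr_nat => /eqP.
Qed.

Lemma entry_eval_line (q : mpoly (n * n) F) (x y : 'M[F]_n) :
  exists p : {poly F}, forall t, p.[t] = entry_eval q (x + t *: (y - x)).
Proof.
exists (\sum_(m <- msupp q) (mcoeff m q)%:P *
  \prod_k ((mxvec x 0 k)%:P + 'X * (mxvec (y - x) 0 k)%:P) ^+ m k) => t.
rewrite /entry_eval mevalE horner_sum; apply: eq_bigr => m _.
rewrite hornerM hornerC horner_prod; congr (_ * _); apply: eq_bigr => k _.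
rewrite horner_exp hornerD hornerM !hornerC hornerX; congr (_ ^+ _).
by case/mxvec_indexP: k => i j; rewrite !mxvecE !mxE.
Qed.

(** If [H] had two disjoint closed pieces, the line through a point of each would,
    away from its singular matrices, be covered by the zero sets of two nonzero
    polynomials in one variable. *)
Lemma connected_line_closed (H : set 'M[F]_n) : H `<=` GL ->
  (forall x y t, H x -> H y -> GL (x + t *: (y - x)) -> H (x + t *: (y - x))) ->
  zariski_connected H.
Proof.
move=> HGL lineH B [x Bx] [U oU BU] [C cC BC].
apply/seteqP; split=> [y|y Hy]; first by rewrite BC => -[].
apply: contrapT => nBy.
have Hx : H x by move: Bx; rewrite BC => -[].
have /zariski_closedP[S CE] := cC.
have /zariski_closedP[S' UE] := open_closedC oU.
have [q Sq qy] : exists2 q, S q & entry_eval q y != 0.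
  apply: contrapT => nq; apply: nBy; rewrite BC; split=> //; rewrite CE => q Sq.
  by apply/eqP/negPn/negP => qy; apply: nq; exists q.
have [q' Sq' qx] : exists2 q, S' q & entry_eval q x != 0.
  apply: contrapT => nq; have : (~` U) x.
    rewrite UE => q' Sq'.
    by apply/eqP/negPn/negP => qy'; apply: nq; exists q'.
  by move: Bx; rewrite BU => -[].
have [p pE] := entry_eval_line q x y.
have [p' pE'] := entry_eval_line q' x y.
have [d dE] := entry_eval_line (\det (generic_mx F n)) x y.
have [t] : exists t, (p * p' * d).[t] != 0.
  apply: poly_nonroot; rewrite !mulf_neq0 //; apply/eqP => z0.
  - move: (pE 1); rewrite z0 horner0 scale1r addrC subrK => /esym/eqP.
    by rewrite (negPf qy).
  - move: (pE' 0); rewrite z0 horner0 scale0r addr0 => /esym/eqP.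
    by rewrite (negPf qx).
  - move: (dE 0); rewrite z0 horner0 scale0r addr0 entry_eval_det => /esym/eqP.
    by apply/negP; rewrite -unitfE -unitmxE; exact: HGL.
rewrite !hornerM !mulf_eq0 !negb_or => /andP[/andP[pt pt'] dt].
set z := x + t *: (y - x).
have Hz : H z.
  by apply: lineH => //; rewrite /GL /= unitmxE unitfE -entry_eval_det -dE.
have [Bz|nBz] := pselect (B z).
  move: Bz; rewrite BC CE => -[_ /(_ q Sq)/eqP].
  by rewrite -pE (negPf pt).
have : (~` U) z by move=> Uz; apply: nBz; rewrite BU.
by rewrite UE => /(_ q' Sq')/eqP; rewrite -pE' (negPf pt').
Qed.

End LineConnected.
(** * Linear algebra *)

Section LinearAlgebra.

(** Row spaces are spans of finitely many vectors; the span of an arbitrary set is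
    obtained as the largest space contained in every space that contains the set. *)
Lemma span_of_set (F : fieldType) m (S : set 'rV[F]_m) : exists Y : 'M[F]_m,
  (forall u, S u -> (u <= Y)%MS) /\
  forall p (X : 'M[F]_(p, m)), (forall u, S u -> (u <= X)%MS) -> (Y <= X)%MS.
Proof.
pose Q (Y : 'M[F]_m) :=
  forall p (X : 'M[F]_(p, m)), (forall u, S u -> (u <= X)%MS) -> (Y <= X)%MS.
pose rk r := `[< exists2 Y, Q Y & \rank Y = r >].
have ex_rk : exists r, rk r.
  by exists 0%N; apply/asboolP; exists 0; [move=> p X _; exact: sub0mx|exact: mxrank0].
have rk_le r : rk r -> (r <= m)%N by move=> /asboolP[Y _ <-]; exact: rank_leq_row.
case: (ex_maxnP ex_rk rk_le) => _ /asboolP[Y QY <-] maxY; exists Y; split=> // u Su.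
have /maxY rkYu : rk (\rank (Y + u)%MS).
  by apply/asboolP; exists (Y + u)%MS => // p X SX; rewrite addsmx_sub QY // SX.
have /mxrank_leqif_sup YYu : (Y <= Y + u)%MS by exact: addsmxSl.
have /esym := YYu.2; rewrite eqn_leq rkYu mxrankS ?addsmxSl //.
by move=> /= YuY; apply: submx_trans (addsmxSr Y u) _; rewrite YuY.
Qed.

Lemma stable_eigenvector (F : numClosedFieldType) m p (f : 'M[F]_m) (W : 'M[F]_(p, m)) :
  W != 0 -> stablemx W f ->
  exists c, exists2 v : 'rV_m, v != 0 & (v <= W)%MS /\ v *m f = c *: v.
Proof.
move=> W0 Wf; pose B := row_base W; have freeB : row_free B by exact: row_base_free.
have Bf : (B *m f <= B)%MS.
  by rewrite eq_row_base (eqmxMr f (eq_row_base W)).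
have [|c /eigenvalueP[u uE u0]] := eigenvalue_closed (B *m f *m pinvmx B).
  by rewrite lt0n mxrank_eq0.
exists c, (u *m B); first by rewrite mulmx_free_eq0.
split; first by rewrite (submx_trans (submxMl _ _)) // eq_row_base.
by rewrite -mulmxA -[B *m f](mulmxKpV Bf) mulmxA uE scalemxAl.
Qed.

Lemma eigenvalues_finite (F : closedFieldType) m (f : 'M[F]_m) :
  exists s : seq F, forall (v : 'rV_m) c, v != 0 -> v *m f = c *: v -> c \in s.
Proof.
have [s sE] := closed_field_poly_normal (char_poly f); exists s => v c v0 vf.
have : eigenvalue f c by apply/eigenvalueP; exists v.
rewrite eigenvalue_root_char sE rootZ ?root_prod_XsubC //.
by rewrite lead_coef_eq0 monic_neq0 ?char_poly_monic.
Qed.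

Lemma complete_first_row (F : fieldType) m (v : 'rV[F]_m.+1) : v != 0 ->
  exists2 c : 'M_m.+1, c \in unitmx & 'e_0 *m c = v.
Proof.
move=> v0; pose e : 'rV[F]_m.+1 := 'e_0.
have ee : e *m (e^T *m v) = v.
  rewrite mulmxA -[RHS]mul1mx; congr (_ *m _); apply/matrixP => i j.
  by rewrite !ord1 trmx_delta mul_delta_mx !mxE !eqxx.
have [|c uc cE] := @complete_unitmx _ _ _ e (e^T *m v).
  by rewrite ee !rank_rV v0 -mxrank_eq0 mxrank_delta.
by exists c => //; rewrite -cE ee.
Qed.

Lemma drsubmxM (F : fieldType) m (A B : 'M[F]_(1 + m)) : ursubmx B = 0 ->
  drsubmx (A *m B) = drsubmx A *m drsubmx B.
Proof.
move=> B0; rewrite -{1}[A]submxK -{1}[B]submxK mulmx_block block_mxKdr.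
by rewrite B0 mulmx0 add0r.
Qed.

Lemma ursubmx0P (F : fieldType) m (A : 'M[F]_(1 + m)) :
  reflect (exists a, ('e_0 : 'rV_(1 + m)) *m A = a *: 'e_0) (ursubmx A == 0).
Proof.
apply: (iffP eqP) => [A0|[a aE]].
  exists (A 0 0); apply/rowP => j; rewrite -rowE !mxE eqxx /=.
  case: (split_ordP j) => k ->; first by rewrite !ord1 lshift0 eqxx mulr1.
  move/matrixP/(_ 0 k): A0; rewrite !mxE lshift0 => ->.
  by rewrite -val_eqE /= mulr0.
apply/rowP => k; move/rowP/(_ (rshift 1 k)): aE.
by rewrite -rowE !mxE lshift0 => ->; rewrite -val_eqE /= mulr0.
Qed.

Lemma unitmx_block1 (F : fieldType) m (d : 'M[F]_m) :
  ((block_mx 1%:M 0 0 d : 'M_(1 + m)) \in unitmx) = (d \in unitmx).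
Proof. by rewrite !unitmxE det_ublock det1 mul1r. Qed.

(** If the first basis vector spans a stable line, triangularizing the action on
    the quotient by this line triangularizes the whole action. *)
Lemma trig_extend (F : fieldType) m (A c : 'M[F]_(1 + m)) (d : 'M[F]_m) :
  c \in unitmx -> d \in unitmx ->
  let M := c *m A *m invmx c in
  ursubmx M = 0 -> is_trig_mx (d *m drsubmx M *m invmx d) ->
  is_trig_mx (block_mx 1%:M 0 0 d *m c *m A *m invmx (block_mx 1%:M 0 0 d *m c)).
Proof.
move=> uc ud M M0 trigM; set b := block_mx _ _ _ d; set e := b *m c.
have ub : b \in unitmx by rewrite unitmx_block1.
have ue : e \in unitmx by rewrite unitmx_mul ub.
have bN (N : 'M_(1 + m)) : ursubmx N = 0 -> b *m N =
    block_mx (ulsubmx N) 0 (d *m dlsubmx N) (d *m drsubmx N *m invmx d) *m b.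
  move=> N0; rewrite -{1}[N]submxK N0 !mulmx_block.
  by rewrite !(mul1mx, mul0mx, mulmx0, mulmx1, addr0, add0r) mulmxKV.
suff -> : e *m A *m invmx e =
    block_mx (ulsubmx M) 0 (d *m dlsubmx M) (d *m drsubmx M *m invmx d).
  by rewrite is_trig_block_mx // eqxx mx11_is_trig.
apply: (canLR (mulmxK ue)); rewrite [RHS]mulmxA -bN //.
by rewrite /M -!mulmxA mulVmx // mulmx1 mulmxA.
Qed.

End LinearAlgebra.
(** * The Lie-Kolchin theorem *)

Section LieKolchin.
Variables (F : numClosedFieldType) (n : nat).
Implicit Types (g h : 'M[F]_n) (G H : set 'M[F]_n).

(** Multiplicativity is only required on [G], so that it passes to the quotient by
    a [G]-stable subspace.  For the same reason [rho (invmx g)] and [invmx (rho g)]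
    may differ away from [G], and regularity of the former is a separate field. *)
Record representation G m (rho : 'M[F]_n -> 'M[F]_m) : Prop := Representation {
  repr1 : rho 1%:M = 1%:M;
  reprM : forall g h, G g -> G h -> rho (g *m h) = rho g *m rho h;
  repr_regular : regular_mx rho;
  repr_inv_regular : regular_mx (rho \o invmx) }.

Lemma representation_id G : representation G id.
Proof. by split=> //; [exact: regular_mx_id|exact: regular_mx_inv]. Qed.

Lemma representation_sub G H m (rho : 'M[F]_n -> 'M[F]_m) :
  H `<=` G -> representation G rho -> representation H rho.
Proof. by move=> HG [r1 rM rr ri]; split=> // g h /HG Gg /HG Gh; exact: rM. Qed.

Definition rep_stable G m (rho : 'M[F]_n -> 'M[F]_m) (U : 'M[F]_m) :=
  forall g, G g -> stablemx U (rho g).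

Definition minimal_stable G m (rho : 'M[F]_n -> 'M[F]_m) (U : 'M[F]_m) :=
  [/\ U != 0, rep_stable G rho U & forall U', rep_stable G rho U' -> U' != 0 ->
    (U' <= U)%MS -> (U <= U')%MS].

Lemma exists_minimal_stable G m (rho : 'M[F]_n -> 'M[F]_m) (W : 'M[F]_m) :
  W != 0 -> rep_stable G rho W ->
  exists2 U, minimal_stable G rho U & (U <= W)%MS.
Proof.
move=> W0 sW.
pose Q U := [/\ U != 0, rep_stable G rho U & (U <= W)%MS].
pose rk r := `[< exists2 U, Q U & \rank U = r >].
have ex_rk : exists r, rk r by exists (\rank W); apply/asboolP; exists W.
case: (ex_minnP ex_rk) => _ /asboolP[U [U0 sU UW] <-] minU; exists U => //.
split=> // U' sU' U'0 U'U; have U'W := submx_trans U'U UW.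
have /minU rkU' : rk (\rank U') by apply/asboolP; exists U'.
by have := (mxrank_leqif_sup U'U).2; rewrite eqn_leq rkU' mxrankS // => <-.
Qed.

Lemma reprK G m (rho : 'M[F]_n -> 'M[F]_m) g :
  is_subgroup G -> representation G rho -> G g -> rho g *m rho (invmx g) = 1%:M.
Proof.
move=> [GGL _ _ GV] [r1 rM _ _] Gg.
by rewrite -rM ?mulmxV //; [exact: GGL|exact: GV].
Qed.

Lemma repr_neq0 G m (rho : 'M[F]_n -> 'M[F]_m) g (v : 'rV_m) :
  is_subgroup G -> representation G rho -> G g -> v != 0 -> v *m rho g != 0.
Proof.
move=> sG rep Gg; apply: contra_neq => vg0.
by rewrite -[v]mulmx1 -(reprK sG rep Gg) mulmxA vg0 mul0mx.
Qed.

(** The span of the orbit of [v] is stable, hence all of [U]. *)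
Lemma minimal_stable_orbit G m p (rho : 'M[F]_n -> 'M[F]_m) (U : 'M[F]_m)
    (v : 'rV[F]_m) (X : 'M[F]_(p, m)) :
  is_subgroup G -> representation G rho -> minimal_stable G rho U ->
  v != 0 -> (v <= U)%MS -> (forall g, G g -> (v *m rho g <= X)%MS) -> (U <= X)%MS.
Proof.
move=> [GGL G1 GM GV] [r1 rM _ _] [U0 sU minU] v0 vU vX.
have [E [orbE Emin]] := span_of_set [set v *m rho g | g in G].
suff UE : (U <= E)%MS.
  by apply: submx_trans UE _; apply: Emin => _ [g Gg <-]; exact: vX.
apply: minU.
- move=> h Gh; have rhoK : rho (invmx h) *m rho h = 1%:M.
    by rewrite -rM ?mulVmx //; [exact: GGL|exact: GV].
  have EX : (E <= E *m rho (invmx h))%MS.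
    apply: Emin => _ [g Gg <-].
    have -> : v *m rho g = v *m rho (g *m h) *m rho (invmx h).
      rewrite -mulmxA -rM; [|exact: GM|exact: GV].
      by rewrite mulmxK //; exact: GGL.
    by rewrite submxMr // orbE //; exists (g *m h) => //; exact: GM.
  by have := submxMr (rho h) EX; rewrite -mulmxA rhoK mulmx1.
- apply: contra_neq v0 => E0; apply/eqP; rewrite -submx0 -E0 orbE //.
  by exists 1%:M => //; rewrite r1 mulmx1.
- apply: Emin => _ [g Gg <-].
  exact: submx_trans (submxMr _ vU) (sU g Gg).
Qed.

Lemma eigenspace_vector m (U f : 'M[F]_m) c (v : 'rV_m) :
  (U <= eigenspace f c)%MS -> (v <= U)%MS -> v *m f = c *: v.
Proof. by move=> Uf vU; apply/eigenspaceP; exact: submx_trans vU Uf. Qed.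

(** The eigenvalue [c g] of [A g] is a regular function of [g], being the ratio of
    two coordinates of a fixed eigenvector [v]; it takes finitely many values,
    because each [c g * a] is an eigenvalue of the single matrix [f]. *)
Lemma connected_eigenvalue_constant G m (v : 'rV[F]_m) (f : 'M[F]_m)
    (A : 'M[F]_n -> 'M[F]_m) (c : 'M[F]_n -> F) a :
  G `<=` GL -> zariski_connected G -> regular_mx A -> v != 0 -> a != 0 ->
  (forall g, G g -> v *m A g = c g *: v) ->
  (forall g, G g -> exists2 w : 'rV_m, w != 0 & w *m f = (c g * a) *: w) ->
  forall g h, G g -> G h -> c g = c h.
Proof.
move=> GGL cG rA v0 a0 vA eig g h Gg Gh.
have [i vi0] : exists i, v 0 i != 0.
  apply: contrapT => /forallNP v_; move/eqP: v0; apply; apply/rowP => i.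
  by rewrite mxE; apply/eqP/negPn/negP; exact: v_.
have [s sP] := eigenvalues_finite f.
pose r x := (v *m A x) 0 i * (a / v 0 i).
have rE x : G x -> r x = c x * a.
  by move=> Gx; rewrite /r vA // mxE; field.
have rr : regular r.
  apply: regularM; last exact: regular_cst.
  by apply: (@regular_mxM _ _ _ _ _ (fun=> v)) => //; exact: regular_mx_cst.
have rs x : G x -> r x \in s.
  by move=> Gx; rewrite rE //; have [w w0 wf] := eig x Gx; exact: sP w0 wf.
apply: (mulIf a0); rewrite -!rE //.
exact: (connected_regular_constant GGL cG rr rs).
Qed.

(** Induction on the derived length.  On a minimal stable subspace, the derived
    subgroup [D] has a common eigenvector.  Its eigencharacter is invariant under
    conjugation by [G], by connectedness, so [D] acts by scalars.  The scalar of a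
    commutator [[x, h]] multiplies an eigenvalue of [h] into another one; by
    connectedness again it equals its value at [x = 1].  So [G] acts by commuting
    operators, and each eigenspace of each of them is everything. *)
Lemma common_eigenvector k G m (rho : 'M[F]_n -> 'M[F]_m) (W : 'M[F]_m) :
  is_subgroup G -> zariski_connected G ->
  iter k (@derived_subgroup F n) G = [set 1%:M] ->
  representation G rho -> W != 0 -> rep_stable G rho W ->
  exists v : 'rV_m, [/\ v != 0, (v <= W)%MS & forall g, G g -> (v *m rho g <= v)%MS].
Proof.
elim: k G rho W => [|k IH] G rho W sG cG solG rep W0 sW.
  have /rowV0Pn[v vW v0] := W0; exists v; split=> // g.
  by move: solG => /= -> ->; rewrite (repr1 rep) mulmx1.
have [GGL G1 GM GV] := sG; have [r1 rM rr ri] := rep.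
have [U minU UW] := exists_minimal_stable W0 sW; have [U0 sU _] := minU.
set D := derived_subgroup G.
have DG : D `<=` G by exact: derived_subgroup_sub.
have [|||||v [v0 vU vD]] := IH D rho U _ _ _ _ U0.
- exact: derived_subgroup_subgroup.
- exact: connected_derived_subgroup.
- by rewrite -solG iterSr.
- exact: representation_sub rep.
- by move=> g /DG; exact: sU.
have /choice[chi chiP] : forall g, exists c, D g -> v *m rho g = c *: v.
  move=> g; have [Dg|nDg] := pselect (D g); last by exists 0.
  by have /sub_rVP[c cE] := vD g Dg; exists c.
have D_scalar d : D d -> (U <= eigenspace (rho d) (chi d))%MS.
  move=> Dd; apply: (minimal_stable_orbit sG rep minU v0 vU) => g Gg.
  have conjD x : G x -> D (x *m d *m invmx x).
    move=> Gx; have [_ _ DM _] := derived_subgroup_subgroup sG.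
    have := DM _ _ (commutator_derived Gx (DG _ Dd)) Dd.
    by rewrite /mxcommutator mulmxKV //; exact: GGL (DG _ Dd).
  have Gd := DG _ Dd.
  have rho_conj x : G x -> rho (x *m d *m invmx x) *m rho x = rho x *m rho d.
    move=> Gx; rewrite -!rM ?mulmxKV //; try exact: GGL; try exact: GM.
    by apply: (GM); [exact: GM|exact: GV].
  have chi_conj : chi (g *m d *m invmx g) = chi (1%:M *m d *m invmx 1%:M).
    apply: (@connected_eigenvalue_constant G _ v (rho d)
      (fun x => rho x *m rho d *m rho (invmx x))
      (fun x => chi (x *m d *m invmx x)) 1) => //.
    + by apply: regular_mxM => //; apply: regular_mxM => //; exact: regular_mx_cst.
    + exact: oner_neq0.
    + by move=> x Gx; rewrite -!rM ?chiP //; do ?[exact: conjD|exact: GM|exact: GV].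
    + move=> x Gx; exists (v *m rho x); first exact: (repr_neq0 sG rep).
      by rewrite mulr1 -(mulmxA v) -rho_conj // mulmxA chiP ?scalemxAl //; exact: conjD.
  apply/eigenspaceP; rewrite -(mulmxA v) -rho_conj // mulmxA chiP; last exact: conjD.
  by rewrite chi_conj mul1mx invmx1 mulmx1 scalemxAl.
have commU g h (u : 'rV_m) : G g -> G h -> (u <= U)%MS ->
    u *m rho g *m rho h = u *m rho h *m rho g.
  move=> Gg Gh uU.
  have [a [w w0 [wU wh]]] := stable_eigenvector U0 (sU h Gh).
  have commE (u' : 'rV_m) x : G x -> (u' <= U)%MS ->
      u' *m rho x *m rho h = chi (mxcommutator x h) *: (u' *m rho h *m rho x).
    move=> Gx u'U; have Dc := commutator_derived Gx Gh.
    rewrite !scalemxAl -(eigenspace_vector (D_scalar _ Dc) u'U).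
    rewrite -!mulmxA -!rM //; try exact: GM; try exact: DG.
    by congr (_ *m rho _); rewrite /mxcommutator !mulmxA !mulmxKV //; exact: GGL.
  have a0 : a != 0.
    by apply: contra_neq (repr_neq0 sG rep Gh w0) => a0; rewrite wh a0 scale0r.
  have Dcomm x : G x -> D (mxcommutator x h) by move=> Gx; exact: commutator_derived.
  have mxcomm1 : mxcommutator 1%:M h = 1%:M.
    by rewrite /mxcommutator mul1mx invmx1 mulmx1 mulmxV //; exact: GGL.
  have chi_comm : chi (mxcommutator g h) = chi (mxcommutator 1%:M h).
    apply: (@connected_eigenvalue_constant G _ v (rho h)
      (fun x => rho x *m rho h *m rho (invmx x) *m rho (invmx h))
      (fun x => chi (mxcommutator x h)) a) => //.
    + by do 2![apply: regular_mxM; last by [|exact: regular_mx_cst]];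
        apply: regular_mxM => //; exact: regular_mx_cst.
    + move=> x Gx; rewrite -chiP; last exact: Dcomm.
      by rewrite -!rM //; do ?[exact: GV|apply: (GM)].
    + move=> x Gx; exists (w *m rho x); first exact: (repr_neq0 sG rep).
      by rewrite commE // wh -scalemxAl scalerA.
  have chi1 : chi (mxcommutator 1%:M h) = 1.
    have := chiP _ (Dcomm _ G1); rewrite {1}mxcomm1 r1 mulmx1 => vE.
    apply/eqP; rewrite -subr_eq0; have := v0; apply: contra_neqT => c0.
    apply: (scalerI c0); rewrite scaler0 scalerBl scale1r -vE subrr //.
  by rewrite commE // chi_comm chi1 scale1r.
exists v; split=> //; first exact: submx_trans vU UW.
move=> g Gg; have [a [w w0 [wU wg]]] := stable_eigenvector U0 (sU g Gg).
apply/sub_rVP; exists a; apply: eigenspace_vector vU.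
apply: (minimal_stable_orbit sG rep minU w0 wU) => x Gx.
by apply/eigenspaceP; rewrite commU // wg scalemxAl.
Qed.

(** The regular action on the quotient by a common eigenvector is triangularized by
    induction on the dimension. *)
Theorem lie_kolchin k G m (rho : 'M[F]_n -> 'M[F]_m) :
  is_subgroup G -> zariski_connected G ->
  iter k (@derived_subgroup F n) G = [set 1%:M] -> representation G rho ->
  exists2 c : 'M_m, c \in unitmx &
    forall g, G g -> is_trig_mx (c *m rho g *m invmx c).
Proof.
move=> sG cG solG; elim: m rho => [|m IH] rho rep.
  exists 1%:M; first exact: unitmx1.
  by move=> g _; apply/is_trig_mxP => -[].
have [||v [v0 _ vG]] := @common_eigenvector k G _ rho 1%:M sG cG solG rep.
- exact: matrix_nonzero1.
- by move=> g _; apply: submx_full; rewrite row_full_unit unitmx1.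
have [c uc cv] := complete_first_row v0.
pose M g : 'M[F]_(1 + m) := c *m rho g *m invmx c.
have M0 g : G g -> ursubmx (M g) = 0.
  move=> Gg; apply/eqP/ursubmx0P; have /sub_rVP[a va] := vG g Gg.
  exists a; rewrite /M !mulmxA cv va -cv -scalemxAl mulmxK //.
have repM : representation G (fun g => drsubmx (M g)).
  have [r1 rM rr ri] := rep; split.
  - rewrite /M r1 mulmx1 mulmxV // -[1%:M]/(1%:M : 'M_(1 + m)).
    by rewrite scalar_mx_block block_mxKdr.
  - move=> g h Gg Gh; rewrite -drsubmxM ?M0 // /M rM // !mulmxA.
    by rewrite mulmxKV.
  - move=> i j; apply: (regular_ext (f := fun g => M g (rshift 1 i) (rshift 1 j))).
      by move=> g _; rewrite !mxE.
    have rM' : regular_mx M.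
      by do ![apply: regular_mxM => //; try exact: regular_mx_cst].
    exact: rM'.
  - move=> i j.
    apply: (regular_ext (f := fun g => M (invmx g) (rshift 1 i) (rshift 1 j))).
      by move=> g _; rewrite !mxE.
    have rM' : regular_mx (M \o invmx).
      by do ![apply: regular_mxM => //; try exact: regular_mx_cst].
    exact: rM'.
have [d ud dP] := IH _ repM.
exists (block_mx 1%:M 0 0 d *m (c : 'M_(1 + m))).
  by rewrite unitmx_mul uc andbT unitmx_block1.
by move=> g Gg; apply: trig_extend => //; [exact: M0|exact: dP].
Qed.

End LieKolchin.
(** * Borel subgroups of the general linear group *)

Section BorelSubgroups.
Variables (F : numClosedFieldType) (n : nat).
Implicit Types (g h A B c : 'M[F]_n.+1).

(** [off_trig 0] is lower triangularity, and [off_trig 1] its strict form; the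
    filtration is multiplicative. *)
Definition off_trig k A := forall i j : 'I_n.+1, (i < j + k)%N -> A i j = 0.

Lemma off_trig0 A : off_trig 0 A <-> is_trig_mx A.
Proof.
split=> [A0|/is_trig_mxP A0 i j]; last by rewrite addn0; exact: A0.
by apply/is_trig_mxP => i j ij; apply: A0; rewrite addn0.
Qed.

Lemma off_trigM k l A B : off_trig k A -> off_trig l B -> off_trig (k + l) (A *m B).
Proof.
move=> Ak Bl i j ij; rewrite mxE big1 // => r _.
have [ir|ri] := ltnP i (r + k); first by rewrite Ak // mul0r.
rewrite Bl ?mulr0 // -(ltn_add2r k); apply: leq_ltn_trans ri _.
by rewrite -addnA [(l + k)%N]addnC.
Qed.

Lemma off_trigD k A B : off_trig k A -> off_trig k B -> off_trig k (A + B).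
Proof. by move=> Ak Bk i j ij; rewrite mxE Ak ?Bk ?addr0. Qed.

Lemma off_trigN k A : off_trig k A -> off_trig k (- A).
Proof. by move=> Ak i j ij; rewrite mxE Ak ?oppr0. Qed.

Lemma off_trigW k l A : (k <= l)%N -> off_trig l A -> off_trig k A.
Proof. by move=> kl Al i j ij; apply: Al; apply: leq_trans ij _; rewrite leq_add2l. Qed.

Lemma is_trig_mxM A B : is_trig_mx A -> is_trig_mx B -> is_trig_mx (A *m B).
Proof. by move=> /off_trig0 A0 /off_trig0 B0; apply/off_trig0/(off_trigM A0 B0). Qed.

Lemma is_trig_horner A f : is_trig_mx A -> is_trig_mx (horner_mx A f).
Proof.
move=> trigA; elim/poly_ind: f => [|f b IH]; first by rewrite rmorph0 mx0_is_trig.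
rewrite rmorphD rmorphM /= horner_mx_X horner_mx_C.
apply/off_trig0/off_trigD; apply/off_trig0; last exact: scalar_mx_is_trig.
exact: is_trig_mxM.
Qed.

Lemma is_trig_invmx A : A \in unitmx -> is_trig_mx A -> is_trig_mx (invmx A).
Proof. by move=> /invmx_horner[f ->]; exact: is_trig_horner. Qed.

Definition conj_mx c g := c *m g *m invmx c.

Lemma conj_mxM c g h : c \in unitmx -> conj_mx c (g *m h) = conj_mx c g *m conj_mx c h.
Proof. by move=> uc; rewrite /conj_mx !mulmxA mulmxKV. Qed.

Lemma conj_mx1 c : c \in unitmx -> conj_mx c 1%:M = 1%:M.
Proof. by move=> uc; rewrite /conj_mx mulmx1 mulmxV. Qed.

Lemma conj_mx_unit c g : c \in unitmx -> (conj_mx c g \in unitmx) = (g \in unitmx).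
Proof. by move=> uc; rewrite !unitmx_mul unitmx_inv uc andbT. Qed.

Lemma conj_mxV c g : c \in unitmx -> g \in unitmx ->
  conj_mx c (invmx g) = invmx (conj_mx c g).
Proof.
move=> uc ug; have ucg : conj_mx c g \in unitmx by rewrite conj_mx_unit.
by apply: (can_inj (mulKmx ucg)); rewrite -conj_mxM // !mulmxV // conj_mx1.
Qed.

(** The stabilizer of the complete flag spanned by the rows of [c]. *)
Definition trig_group c : set 'M[F]_n.+1 :=
  [set g | GL g /\ is_trig_mx (conj_mx c g)].

Definition unitrig_group c k : set 'M[F]_n.+1 :=
  [set g | GL g /\ off_trig k (conj_mx c g - 1%:M)].

Lemma trig_group_subgroup c : c \in unitmx -> is_subgroup (trig_group c).
Proof.
move=> uc; split.
- by move=> g [].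
- by split; [rewrite /GL /= unitmx1|rewrite conj_mx1 // scalar_mx_is_trig].
- move=> g h [ug tg] [uh th]; split; first exact: GLM.
  by rewrite conj_mxM // is_trig_mxM.
- move=> g [ug tg]; split; first exact: GLV.
  by rewrite conj_mxV // is_trig_invmx // conj_mx_unit.
Qed.

Lemma unitrig_group_trig c k g : unitrig_group c k g -> trig_group c g.
Proof.
move=> [ug tg]; split=> //; apply/off_trig0; rewrite -[conj_mx c g](subrK 1%:M).
apply: off_trigD; first exact: off_trigW tg.
by apply/off_trig0; exact: scalar_mx_is_trig.
Qed.

Lemma unitrig_group_subgroup c k : c \in unitmx -> is_subgroup (unitrig_group c k).
Proof.
move=> uc; have [_ _ _ TV] := trig_group_subgroup uc; split.
- by move=> g [].
- by split; [rewrite /GL /= unitmx1|rewrite conj_mx1 // subrr => i j _; rewrite mxE].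
- move=> g h Ug Uh; have [_ /off_trig0 tg] := unitrig_group_trig Ug.
  move: Ug Uh => [ug Ug] [uh Uh]; split; first exact: GLM.
  have -> : conj_mx c (g *m h) - 1%:M =
      conj_mx c g *m (conj_mx c h - 1%:M) + (conj_mx c g - 1%:M).
    by rewrite conj_mxM // mulmxBr mulmx1 addrA subrK.
  by apply: off_trigD => //; exact: (off_trigM tg Uh).
- move=> g Ug; have [ug' /off_trig0 tg'] := TV _ (unitrig_group_trig Ug).
  move: Ug => [ug Ug]; split=> //.
  have -> : conj_mx c (invmx g) - 1%:M =
      - (conj_mx c (invmx g) *m (conj_mx c g - 1%:M)).
    by rewrite mulmxBr -conj_mxM // mulVmx // conj_mx1 // mulmx1 opprB.
  by apply: off_trigN; exact: (off_trigM tg' Ug).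
Qed.

(** This form makes visible that the commutator is deeper in the filtration than
    its arguments: the first factor is a commutator of matrices. *)
Lemma conj_mx_commutator c g h : c \in unitmx -> GL g -> GL h ->
  conj_mx c (mxcommutator g h) - 1%:M =
  (conj_mx c g *m conj_mx c h - conj_mx c h *m conj_mx c g)
    *m (conj_mx c (invmx g) *m conj_mx c (invmx h)).
Proof.
move=> uc ug uh; rewrite mulmxBl -!conj_mxM // /mxcommutator !mulmxA.
by rewrite (mulmxK (ug : g \in unitmx)) mulmxV // conj_mx1.
Qed.

Lemma trig_mulmx_diag A B i : is_trig_mx A -> is_trig_mx B ->
  (A *m B) i i = A i i * B i i.
Proof.
move=> /is_trig_mxP A0 /is_trig_mxP B0; rewrite mxE (bigD1 i) //= big1 ?addr0 // => r.
by rewrite -val_eqE /= neq_ltn => /orP[/B0|/A0] ->; rewrite ?mulr0 ?mul0r.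
Qed.

Lemma trig_commutator A B : is_trig_mx A -> is_trig_mx B ->
  off_trig 1 (A *m B - B *m A).
Proof.
move=> tA tB i j; rewrite addn1 ltnS leq_eqVlt => ij.
rewrite mxE [X in _ + X]mxE.
case/orP: ij => [/eqP/val_inj ->|ij].
  by rewrite !trig_mulmx_diag // mulrC subrr.
by rewrite !(is_trig_mxP (is_trig_mxM _ _) _ _ ij) // subrr.
Qed.

Lemma derived_trig_group c : c \in unitmx ->
  derived_subgroup (trig_group c) `<=` unitrig_group c 1.
Proof.
move=> uc; apply: smallest_sub; first exact: unitrig_group_subgroup.
move=> _ [g Tg [h Th <-]]; have [_ _ _ TV] := trig_group_subgroup uc.
have [_ tg'] := TV _ Tg; have [_ th'] := TV _ Th.
move: Tg Th => [ug tg] [uh th].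
split; first by rewrite /mxcommutator; do ![apply: GLM|apply: GLV].
rewrite conj_mx_commutator // -[1%N]addn0; apply: off_trigM.
  exact: trig_commutator.
by apply/off_trig0; exact: is_trig_mxM.
Qed.

Lemma derived_unitrig_group c k : c \in unitmx ->
  derived_subgroup (unitrig_group c k.+1) `<=` unitrig_group c k.+2.
Proof.
move=> uc; apply: smallest_sub; first exact: unitrig_group_subgroup.
move=> _ [g Ug [h Uh <-]]; have [_ _ _ TV] := trig_group_subgroup uc.
have [_ tg'] := TV _ (unitrig_group_trig Ug).
have [_ th'] := TV _ (unitrig_group_trig Uh).
move: Ug Uh => [ug Ug] [uh Uh].
split; first by rewrite /mxcommutator; do ![apply: GLM|apply: GLV].
rewrite conj_mx_commutator // -[k.+2]addn0; apply: off_trigM; last first.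
  by apply/off_trig0; exact: is_trig_mxM.
set X := conj_mx c g in Ug *; set Y := conj_mx c h in Uh *.
have -> : X *m Y - Y *m X =
    (X - 1%:M) *m (Y - 1%:M) - (Y - 1%:M) *m (X - 1%:M).
  have expand M N : (M - 1%:M) *m (N - 1%:M) = M *m N - (M + N - 1%:M).
    by rewrite mulmxBl !mulmxBr !mul1mx !mulmx1 -addrA -opprD addrA.
  have cancel (a b s : 'M[F]_n.+1) : a - s - (b - s) = a - b.
    by rewrite opprB addrA subrK.
  by rewrite !expand [Y + X]addrC cancel.
apply: (@off_trigW _ (k.+1 + k.+1)); first by rewrite addSn addnS ltnS ltnS leq_addr.
by apply: off_trigD; [|apply: off_trigN]; exact: off_trigM.
Qed.

Lemma trig_group_solvable c : c \in unitmx -> solvable_subgroup (trig_group c).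
Proof.
move=> uc; exists n.+1; set D := iter _ _ _.
have sub k :
    iter k.+1 (@derived_subgroup F n.+1) (trig_group c) `<=` unitrig_group c k.+1.
  elim: k => [|k IH]; first exact: derived_trig_group.
  rewrite iterS; apply: subset_trans (derived_unitrig_group uc).
  move=> g Dg H [sH HU]; apply: Dg; split=> //.
  move=> _ [x Dx [y Dy <-]]; apply: HU; exists x; first exact: IH.
  by exists y => //; exact: IH.
have sD k : is_subgroup (iter k (@derived_subgroup F n.+1) (trig_group c)).
  elim: k => [|k IH]; first exact: trig_group_subgroup.
  by rewrite iterS; exact: derived_subgroup_subgroup.
apply/seteqP; split=> [g|_ ->]; last by case: (sD n.+1).
move=> /sub[ug Ug]; suff cg : conj_mx c g = 1%:M.
  by rewrite /= -[g](mulKmx uc) -[c *m g](mulmxKV uc) -/(conj_mx c g) cg mul1mx mulVmx.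
apply/eqP; rewrite -subr_eq0; apply/eqP/matrixP => i j.
by rewrite Ug ?mxE // ltn_addl.
Qed.

Lemma trig_group_connected c : c \in unitmx -> zariski_connected (trig_group c).
Proof.
move=> uc; apply: connected_line_closed; first by move=> g [].
move=> x y t [_ tx] [_ ty] uz; split=> //.
have -> : conj_mx c (x + t *: (y - x)) =
    conj_mx c x + t%:M *m (conj_mx c y - conj_mx c x).
  rewrite /conj_mx mulmxDr mulmxDl -scalemxAr -scalemxAl mul_scalar_mx.
  by rewrite mulmxBr mulmxBl.
move: tx ty => /off_trig0 tx /off_trig0 ty; apply/off_trig0/off_trigD => //.
apply: (@off_trigM 0 0); first by apply/off_trig0; exact: scalar_mx_is_trig.
by apply: off_trigD => //; exact: off_trigN.
Qed.

Lemma trig_group_closed c : zariski_closed (trig_group c).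
Proof.
have [|Z cZ ZE] := @regular_zero_closed F n.+1
  {ij : 'I_n.+1 * 'I_n.+1 | (ij.1 < ij.2)%N}
  (fun ij g => conj_mx c g (sval ij).1 (sval ij).2).
  move=> ij; have rc : regular_mx (conj_mx c).
    by do ![apply: regular_mxM; last exact: regular_mx_cst|apply: regular_mxM]
      => //; [exact: regular_mx_cst|exact: regular_mx_id].
  exact: rc.
exists Z => //; rewrite -ZE; apply/seteqP; split=> g [ug] /=.
  by move=> /is_trig_mxP tg; split=> // -[[i j] /= ij]; exact: tg.
by move=> tg; split=> //; apply/is_trig_mxP => i j ij; exact: (tg (exist _ (i, j) ij)).
Qed.

(** Lie-Kolchin puts [B] inside a triangular group; the latter is itself closed,
    connected and solvable, so it equals [B] by maximality. *)
Lemma borel_subgroup_trig (B : set 'M[F]_n.+1) : borel_subgroup GL B ->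
  exists2 c, c \in unitmx & B = trig_group c.
Proof.
move=> [[sB BGL _ cB [k solB]] maxB].
have [c uc cP] := lie_kolchin sB cB solB (representation_id B).
exists c => //; apply/esym/maxB; last by move=> g Bg; split; [exact: BGL|exact: cP].
split; [exact: trig_group_subgroup|by move=> g []|exact: trig_group_closed| |].
  exact: trig_group_connected.
exact: trig_group_solvable.
Qed.

End BorelSubgroups.
(** * Subgroups containing the triangular group *)

Section GroupsContainingTriangular.
Variable F : numClosedFieldType.

(** With row vectors, lower triangular matrices fix the flag of the spans of
    ['e_0, ..., 'e_i], and the leading entry of a vector is its last nonzero one. *)
Definition has_lead n (v : 'rV[F]_n) (i : 'I_n) :=
  v 0 i != 0 /\ forall j : 'I_n, (i < j)%N -> v 0 j = 0.

Lemma exists_lead n (v : 'rV[F]_n.+1) : v != 0 -> exists i, has_lead v i.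
Proof.
move=> v0; have [i0 vi0] : exists i, v 0 i != 0.
  apply: contrapT => /forallNP v_; move/eqP: v0; apply; apply/rowP => i.
  by rewrite mxE; apply/eqP/negPn/negP; exact: v_.
case: (@arg_maxnP _ i0 (fun i => v 0 i != 0) (fun i => nat_of_ord i) vi0) => i vi maxi.
exists i; split=> // j ij; apply/eqP/negPn/negP => /maxi /=.
by rewrite leqNgt ij.
Qed.

(** The matrix [t] is the identity plus a rank one matrix supported on row [i]. *)
Lemma triangular_transitive_on_lead n (u v : 'rV[F]_n.+1) i :
  has_lead u i -> has_lead v i ->
  exists2 t : 'M_n.+1, GL t /\ is_trig_mx t & u *m t = v.
Proof.
move=> [ui u0] [vi v0]; pose w := (u 0 i)^-1 *: (v - u).
pose t : 'M[F]_n.+1 := 1%:M + delta_mx i 0 *m w.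
have tE r s : t r s = (r == s)%:R + (r == i)%:R * w 0 s.
  by rewrite /t !mxE big_ord1 !mxE eqxx andbT; congr (_ + _ * _).
have w0 (s : 'I_n.+1) : (i < s)%N -> w 0 s = 0.
  by move=> si; rewrite !mxE (u0 s) // (v0 s) // subrr mulr0.
have trigt : is_trig_mx t.
  apply/is_trig_mxP => r s rs; rewrite tE -val_eqE ltn_eqF // add0r.
  by have [ri|] := eqVneq r i; rewrite ?mul0r // w0 ?mulr0 // -ri.
exists t; last first.
  rewrite /t mulmxDr mulmx1 mulmxA -(colE i u).
  have -> : col i u = (u 0 i)%:M by apply/matrixP => a b; rewrite !ord1 !mxE mulr1n.
  by rewrite mul_scalar_mx /w scalerA mulfV // scale1r addrC subrK.
split=> //; rewrite /GL /= unitmxE (det_trig trigt) unitfE.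
apply/prodf_neq0 => r _; rewrite tE eqxx.
have [->|_] := eqVneq r i; last by rewrite mul0r addr0 oner_neq0.
by rewrite !mxE mul1r mulrBr mulVf // addrC subrK mulf_neq0 ?invr_eq0.
Qed.

(** Let [m] be the largest leading index in the orbit of ['e_0], and [V] the span of
    ['e_0, ..., 'e_m].  The vectors with leading index [m] lie in the orbit and span
    [V], so [V] is stable.  In fact every nonzero [v] in [V] is in the orbit.  Take
    [p0] in [P] with ['e_0 *m p0 = 'e_m].  If [v *m p0] has leading index [m], then
    it is in the orbit, and so is [v].  Otherwise this applies to [v + 'e_0], which
    has the same leading index as [v] unless [v] is a multiple of ['e_0].  Hence an
    eigenvector of [a] in [V] has the form ['e_0 *m p] with [p] in [P]. *)
Lemma fixed_line_in_orbit n (P : set 'M[F]_n.+1) (a : 'M[F]_n.+1) :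
  is_subgroup P -> (forall t, GL t -> is_trig_mx t -> P t) -> P a ->
  exists2 p, P p & exists l, 'e_0 *m (p *m a *m invmx p) = l *: ('e_0 : 'rV_n.+1).
Proof.
move=> [PGL P1 PM PV] TP Pa.
pose orb (v : 'rV[F]_n.+1) := exists2 p, P p & 'e_0 *m p = v.
have orbM v p : orb v -> P p -> orb (v *m p).
  by move=> [q Pq <-] Pp; exists (q *m p); [exact: PM|rewrite mulmxA].
have orb_lead u v i : has_lead u i -> has_lead v i -> orb u -> orb v.
  move=> ui vi ou; have [t [ut tt] <-] := triangular_transitive_on_lead ui vi.
  by apply: (orbM) => //; exact: TP.
have e0_lead : has_lead ('e_0 : 'rV[F]_n.+1) 0.
  by split=> [|j j0]; rewrite !mxE eqxx ?oner_neq0 // -val_eqE /= gtn_eqF.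
have orb_e0 : orb 'e_0 by exists 1%:M => //; rewrite mulmx1.
have orb_neq0 v : orb v -> v != 0.
  move=> [p Pp <-]; apply/eqP => e0.
  have := mulmxK (PGL _ Pp) ('e_0 : 'rV[F]_n.+1); rewrite e0 mul0mx => /rowP/(_ 0).
  by rewrite !mxE eqxx => /esym/eqP; rewrite oner_eq0.
pose leads (i : 'I_n.+1) := `[< exists2 v, orb v & has_lead v i >].
have leads0 : leads 0 by apply/asboolP; exists 'e_0.
case: (@arg_maxnP _ 0 leads (fun i => nat_of_ord i) leads0).
move=> m /asboolP[vm ovm vm_m] maxm.
pose inV (v : 'rV[F]_n.+1) := forall j : 'I_n.+1, (m < j)%N -> v 0 j = 0.
have orbV v : orb v -> inV v.
  move=> ov j mj; have [i [vi v_]] := exists_lead (orb_neq0 v ov).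
  by apply: (v_); apply: (leq_ltn_trans _ mj); apply: (maxm i); apply/asboolP; exists v.
have em_lead : has_lead ('e_m : 'rV[F]_n.+1) m.
  by split=> [|j j0]; rewrite !mxE !eqxx ?oner_neq0 // -val_eqE /= gtn_eqF.
have orb_em : orb 'e_m by exact: orb_lead vm_m em_lead ovm.
have inVD u v : inV u -> inV v -> inV (u + v).
  by move=> uV vV j mj; rewrite mxE uV ?vV ?addr0.
have inVN u : inV u -> inV (- u) by move=> uV j mj; rewrite mxE uV ?oppr0.
have stable v p : inV v -> P p -> inV (v *m p).
  have gen u : inV u -> u 0 m != 0 -> P p -> inV (u *m p).
    by move=> uV um Pp; apply/orbV/orbM => //; exact: (orb_lead 'e_m u m).
  move=> vV Pp; have [vm0|vm0] := eqVneq (v 0 m) 0; last exact: gen.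
  rewrite -[v](addrK 'e_m) mulmxDl mulNmx; apply: (inVD).
    apply: (gen) => //; first by apply: (inVD) => //; case: em_lead.
    by rewrite mxE vm0 add0r; case: em_lead.
  by apply: (inVN); apply/orbV/orbM.
have [p0 Pp0 p0E] := orb_em.
have Vorb v : inV v -> v != 0 -> orb v.
  have gen u : inV u -> (u *m p0) 0 m != 0 -> orb u.
    move=> uV um; rewrite -[u](mulmxK (PGL _ Pp0)); apply: (orbM); last exact: PV.
    apply: (orb_lead 'e_m _ m) => //; split=> //; exact: stable.
  move=> vV v0; have [vm0|] := eqVneq ((v *m p0) 0 m) 0; last exact: gen.
  have [i [vi v_]] := exists_lead v0.
  have [i0|i0] := eqVneq i 0; first by apply: (orb_lead 'e_0 v 0) => //; rewrite -i0.
  apply: (orb_lead (v + 'e_0) v i) => //.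
    have e0i (j : 'I_n.+1) : j != 0 -> ('e_0 : 'rV[F]_n.+1) 0 j = 0.
      by move=> j0; rewrite mxE (negPf j0) andbF.
    split=> [|j ij]; rewrite mxE e0i ?addr0 //; first exact: v_.
    by rewrite -val_eqE /= -lt0n (leq_ltn_trans _ ij).
  apply: (gen).
    by apply: (inVD) => // j mj; apply: (e0_lead.2); apply: (leq_ltn_trans _ mj).
  by rewrite mulmxDl p0E mxE vm0 add0r; case: em_lead.
pose V : 'M[F]_n.+1 := \matrix_(i, j) ((i == j) && (i <= m)%N)%:R.
have inVP (v : 'rV_n.+1) : (v <= V)%MS <-> inV v.
  split=> [/submxP[u ->] j mj|vV].
    rewrite mxE; apply: big1 => i _; rewrite mxE.
    have [->|_] := eqVneq i j; last by rewrite mulr0.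
    by rewrite leqNgt mj mulr0.
  apply/submxP; exists v; apply/rowP => j; rewrite mxE (bigD1 j) //= big1.
    rewrite mxE eqxx addr0 /=; have [_|mj] := leqP j m; first by rewrite mulr1.
    by rewrite vV // mul0r.
  by move=> i ij; rewrite mxE (negPf ij) mulr0.
have V0 : V != 0.
  apply/eqP => /matrixP/(_ 0 0)/eqP; rewrite !mxE eqxx /= ?leq0n oner_eq0 //.
have Va : stablemx V a.
  apply/row_subP => i; rewrite row_mul; apply/inVP; apply: (stable) => //.
  by apply/inVP; exact: row_sub.
have [l [v v0 [vV va]]] := stable_eigenvector V0 Va.
have [p Pp pE] : orb v by apply: (Vorb) => //; apply/inVP.
exists p => //; exists l.
by rewrite !mulmxA pE va -pE -scalemxAl mulmxK //; exact: PGL.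
Qed.

(** After a conjugation in [P], the element [a] fixes the first basis line, and the
    induction applies to the blocks [d] for which [block_mx 1%:M 0 0 d] is in [P]:
    multiplication by triangular matrices clears the first column. *)
Lemma conj_into_triangular n (P : set 'M[F]_n) (a : 'M[F]_n) :
  is_subgroup P -> (forall t, GL t -> is_trig_mx t -> P t) -> P a ->
  exists2 p, P p & is_trig_mx (p *m a *m invmx p).
Proof.
elim: n P a => [|n IH] P a sP TP Pa.
  by exists a => //; apply/is_trig_mxP => -[].
have [PGL P1 PM PV] := sP.
have [p Pp [l lE]] := fixed_line_in_orbit sP TP Pa.
have up : p \in unitmx by exact: PGL.
pose M : 'M[F]_(1 + n) := p *m a *m invmx p.
have PM' : P M by apply: (PM); [exact: PM|exact: PV].
have M0 : ursubmx M = 0 by apply/eqP/ursubmx0P; exists l.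
have : M \in unitmx by exact: PGL.
rewrite -[M in M \in _]submxK M0 unitmxE det_lblock unitrM -!unitmxE => /andP[uL uD].
pose P' : set 'M[F]_n := [set d | P (block_mx 1%:M 0 0 d : 'M_(1 + n))].
have block1M (d e : 'M[F]_n) : (block_mx 1%:M 0 0 (d *m e) : 'M_(1 + n)) =
    block_mx 1%:M 0 0 d *m block_mx 1%:M 0 0 e.
  by rewrite mulmx_block !(mul1mx, mul0mx, mulmx0, addr0, add0r).
have sP' : is_subgroup P'.
  split.
  - by move=> d /PGL; rewrite /GL /= unitmx_block1.
  - by rewrite /P' /= -scalar_mx_block.
  - by move=> d e Pd Pe; rewrite /P' /= block1M; exact: PM.
  - move=> d Pd; have ub := PGL _ Pd.
    have ud : d \in unitmx by move: ub; rewrite /GL /= unitmx_block1.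
    rewrite /P' /= (_ : block_mx _ _ _ _ = invmx (block_mx 1%:M 0 0 d : 'M_(1 + n))).
      exact: PV.
    apply: (can_inj (mulKmx (ub : _ \in unitmx))).
    by rewrite mulmxV // -block1M mulmxV // -scalar_mx_block.
have TP' t : GL t -> is_trig_mx t -> P' t.
  move=> ut tt; apply: TP; first by rewrite /GL /= unitmx_block1.
  by rewrite (@is_trig_block_mx _ 1 n 1 n) // eqxx tt mx11_is_trig.
have PD : P' (drsubmx M).
  pose L := ulsubmx M; pose x := dlsubmx M; pose D := drsubmx M.
  pose t : 'M[F]_(1 + n) := block_mx (invmx L) 0 (- (invmx D *m (x *m invmx L))) 1%:M.
  have -> : P' (drsubmx M) = P (M *m t).
    congr P; rewrite -[M in RHS]submxK M0 mulmx_block -/L -/x -/D.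
    rewrite !(mul0mx, mulmx0, mulmx1, addr0, add0r) mulmxV //.
    by rewrite mulmxN mulKVmx // subrr.
  apply: (PM) => //; apply: TP.
    suff : t \in unitmx by [].
    by rewrite unitmxE (@det_lblock _ 1 n) det1 mulr1 -unitmxE unitmx_inv.
  by rewrite (@is_trig_block_mx _ 1 n 1 n) // eqxx mx11_is_trig scalar_mx_is_trig.
have [d P'd trigd] := IH P' (drsubmx M) sP' TP' PD.
exists (block_mx 1%:M 0 0 d *m (p : 'M_(1 + n))); first exact: PM.
apply: trig_extend => //.
by have [P'GL _ _ _] := sP'; exact: P'GL.
Qed.

End GroupsContainingTriangular.

(** * Polynomials in elements of a parabolic subgroup *)

Section Parabolic.
Variables (F : numClosedFieldType) (n : nat).

(** The triangular group is the group of units of an algebra, so it contains the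
    invertible polynomials in its elements; and every element of [P] is conjugate
    under [P] into a triangular group contained in [P]. *)
Lemma parabolic_horner (P : set 'M[F]_n.+1) (a : 'M[F]_n.+1) f :
  parabolic_subgroup GL P -> P a -> GL (horner_mx a f) -> P (horner_mx a f).
Proof.
move=> [sP _ _ [B /borel_subgroup_trig[c uc ->] TP]] Pa ufa.
have [PGL P1 PM PV] := sP; have uc' : invmx c \in unitmx by rewrite unitmx_inv.
have conjK g : conj_mx (invmx c) (conj_mx c g) = g.
  by rewrite /conj_mx invmxK !mulmxA mulVmx // mul1mx mulmxKV.
have conjKV g : conj_mx c (conj_mx (invmx c) g) = g.
  by rewrite /conj_mx invmxK !mulmxA mulmxV // mul1mx mulmxK.
pose P' := [set g | P (conj_mx (invmx c) g)].
have sP' : is_subgroup P'.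
  split.
  - by move=> g /PGL; rewrite /GL /= conj_mx_unit.
  - by rewrite /P' /= conj_mx1.
  - by move=> g h Pg Ph; rewrite /P' /= conj_mxM //; exact: PM.
  - move=> g Pg; rewrite /P' /= conj_mxV //; first exact: PV.
    by have := PGL _ Pg; rewrite /GL /= conj_mx_unit.
have [||p P'p trigp] := @conj_into_triangular F _ P' (conj_mx c a) sP'.
- move=> t ut tt; apply: TP; split; last by rewrite conjKV.
  by rewrite /GL /= conj_mx_unit.
- by rewrite /P' /= conjK.
have [P'GL _ P'M P'V] := sP'; have up : p \in unitmx by exact: P'GL.
suff P'f : P' (conj_mx c (horner_mx a f)) by rewrite -[horner_mx a f]conjK.
have P't : P' (conj_mx p (conj_mx c (horner_mx a f))).
  apply: TP; split; first by rewrite /GL /= !conj_mx_unit.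
  rewrite conjKV /conj_mx -!horner_mx_uconj //; exact: is_trig_horner.
have -> : conj_mx c (horner_mx a f) =
    invmx p *m conj_mx p (conj_mx c (horner_mx a f)) *m p.
  by rewrite {2}/conj_mx !mulmxA mulVmx // mul1mx mulmxKV.
by apply: (P'M) => //; apply: (P'M) => //; exact: P'V.
Qed.

End Parabolic.
(** * Orbits on double and triple flag varieties *)

Section Orbits.
Variables (F : numClosedFieldType) (n : nat) (J : 'M[F]_n.+1).
Implicit Types (g h k : 'M[F]_n.+1) (P Q S : set 'M[F]_n.+1).
Local Notation K := (fixed_subgroup J).

Hypothesis uJ : J \in unitmx.
Hypothesis thetaK : forall g, GL g -> theta J (theta J g) = g.

Lemma theta_GL g : GL g -> GL (theta J g).
Proof. by rewrite /GL /= !unitmx_mul unitmx_tr !unitmx_inv uJ => ->. Qed.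

Lemma thetaV g : GL g -> theta J (invmx g) = invmx (theta J g).
Proof.
move=> ug; have ut : theta J g \in unitmx by exact: theta_GL.
apply: (can_inj (mulKmx ut)); rewrite mulmxV // -thetaM //; last exact: GLV.
by rewrite mulmxV // /theta invmx1 trmx1 mulmx1 mulmxV.
Qed.

Lemma trmx_horner (a : 'M[F]_n.+1) f : (horner_mx a f)^T = horner_mx a^T f.
Proof.
elim/poly_ind: f => [|f b IH]; first by rewrite !rmorph0 trmx0.
rewrite !rmorphD !rmorphM /= !horner_mx_X !horner_mx_C raddfD /= tr_scalar_mx.
by rewrite trmx_mul IH; congr (_ + _); exact: comm_mx_horner.
Qed.

Lemma theta_invmx_horner (a : 'M[F]_n.+1) f :
  theta J (invmx a) = a -> J *m (horner_mx a f)^T *m invmx J = horner_mx a f.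
Proof.
by rewrite /theta invmxK => aE; rewrite trmx_horner -horner_mx_uconj // aE.
Qed.

(** The matrix [a = theta(h)^-1 h] satisfies [theta(a) = a^-1] and lies in both
    parabolic subgroups, [P3] and the conjugate of [P] by [g1].  If [p] is a
    polynomial in [a] with [a p^2 = 1], then [p] also lies in both of them and
    [theta(p) = p^-1 = a p], because [theta] composed with inversion is linear on the
    algebra generated by [a].  Hence [theta(h p) = theta(h) a p = h p]. *)
Lemma fixed_representative P P3 g1 g2 h :
  parabolic_subgroup GL P -> parabolic_subgroup GL P3 -> theta J @` P3 = P3 ->
  GL g1 -> GL g2 -> P3 h ->
  P (invmx g2 *m h *m g1) -> P (invmx g2 *m theta J h *m g1) ->
  exists k, [/\ P3 k, K k & P (invmx g2 *m k *m g1)].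
Proof.
move=> parP parP3 thetaP3 ug1 ug2 P3h Ph Pth.
have [[PGL _ PM PV] _ _ _] := parP; have [[P3GL _ P3M P3V] _ _ _] := parP3.
have uh := P3GL _ P3h.
have [s sE] : exists s, theta J h = s by exists (theta J h).
have us : s \in unitmx by rewrite -sE; exact: theta_GL.
have thetas : theta J s = h by rewrite -sE thetaK.
rewrite sE in Pth.
pose a := invmx s *m h.
have P3a : P3 a by apply: (P3M) => //; apply: P3V; rewrite -thetaP3; exists h.
have ua : a \in unitmx by exact: P3GL.
have thetaa : theta J (invmx a) = a.
  rewrite thetaV //; apply: (can_inj (mulKmx (theta_GL ua : _ \in unitmx))).
  rewrite mulmxV ?theta_GL // /a thetaM //; last exact: GLV.
  by rewrite thetaV // thetas sE !mulmxA mulmxK // mulVmx.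
have [f aff] := inv_sqrt_mx ua; set p := horner_mx a f in aff.
have up : p \in unitmx.
  have : a *m p *m p \in unitmx by rewrite -mulmxA aff unitmx1.
  by rewrite unitmx_mul => /andP[].
have Vp : invmx p = a *m p.
  by rewrite -[LHS]mul1mx -aff mulmxA mulmxK.
have P3p : P3 p by exact: parabolic_horner.
have Pp : P (invmx g1 *m p *m g1).
  rewrite -horner_mx_uconjC //; apply: parabolic_horner => //.
    have -> : invmx g1 *m a *m g1 =
        invmx (invmx g2 *m s *m g1) *m (invmx g2 *m h *m g1).
      rewrite !invmxM //; try exact: GLV; last by apply: GLM => //; exact: GLV.
      by rewrite invmxK /a !mulmxA mulmxK.
    by apply: (PM) => //; exact: PV.
  by rewrite horner_mx_uconjC // /GL /= !unitmx_mul unitmx_inv ug1 up.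
exists (h *m p); split; first exact: P3M; last first.
  have -> : invmx g2 *m (h *m p) *m g1 =
      (invmx g2 *m h *m g1) *m (invmx g1 *m p *m g1).
    by rewrite !mulmxA mulmxK.
  exact: PM.
split; first exact: GLM.
rewrite thetaM // sE.
have -> : theta J p = a *m p.
  rewrite /theta Vp (_ : a *m p = horner_mx a ('X * f)).
    exact: theta_invmx_horner.
  by rewrite rmorphM /= horner_mx_X.
by rewrite mulmxA /a mulKVmx.
Qed.

Lemma ltransM g h S : ltrans (g *m h) S = ltrans g (ltrans h S).
Proof.
apply/seteqP; split=> [_ [x Sx <-]|_ [_ [x Sx <-] <-]].
  by exists (h *m x); [exists x|rewrite mulmxA].
by exists x => //; rewrite mulmxA.
Qed.

Lemma ltrans1 S : ltrans 1%:M S = S.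
Proof.
by apply/seteqP; split=> [_ [x Sx <-]|x Sx]; [rewrite mul1mx|exists x; rewrite ?mul1mx].
Qed.

Lemma ltrans_eq P g h : is_subgroup P -> GL g -> GL h ->
  ltrans g P = ltrans h P <-> P (invmx h *m g).
Proof.
move=> [PGL P1 PM PV] ug uh; split=> [gh|Phg].
  have : ltrans g P g by exists 1%:M; rewrite ?mulmx1.
  by rewrite gh => -[p Pp <-]; rewrite mulKmx.
rewrite (_ : g = h *m (invmx h *m g)); last by rewrite mulKVmx.
rewrite ltransM; congr ltrans; move: (_ *m _) Phg => p Pp.
apply/seteqP; split=> [_ [x Px <-]|x Px]; first exact: PM.
exists (invmx p *m x); first by apply: (PM) => //; exact: PV.
by rewrite mulKVmx //; exact: PGL.
Qed.

Lemma double_actM g h x : double_act (g *m h) x = double_act g (double_act h x).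
Proof. by rewrite /double_act !ltransM. Qed.

Lemma triple_actM g h x : triple_act (g *m h) x = triple_act g (triple_act h x).
Proof. by rewrite /triple_act !ltransM. Qed.

Lemma triple_act1 (x : set 'M[F]_n.+1 * (set 'M[F]_n.+1 * set 'M[F]_n.+1)) :
  triple_act 1%:M x = x.
Proof. by case: x => ? [? ?]; rewrite /triple_act !ltrans1. Qed.

Lemma orbit_map_orbit P P3 Q x :
  P `<=` GL -> double_flag J Q P x ->
  orbit_map J P3 (group_orbit K (@double_act _ n.+1) x) =
  group_orbit GL (@triple_act _ n.+1) (flag_emb J P3 x).
Proof.
move=> PGL xF; apply/seteqP; split=> y.
  move=> [g ug [_ [_ [k Kk <-] <-] <-]]; exists (g *m k).
    by apply: GLM => //; case: Kk.
  by rewrite triple_actM (flag_emb_equivariant _ uJ PGL Kk xF).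
move=> [g ug <-]; exists g => //; exists (flag_emb J P3 x) => //; exists x => //.
exists 1%:M; last by rewrite /double_act !ltrans1; case: (x).
by split; rewrite /GL /= ?unitmx1 // /theta invmx1 trmx1 mulmx1 mulmxV.
Qed.

(** Translating by [k1] and [k2] reduces to base points in [G/P3], so that the
    element [h'] lies in [P3]; applying [theta] to the third coordinate gives the
    condition on [theta h'] that [fixed_representative] asks for. *)
Lemma double_orbit_of_triple P P3 Q x y h :
  parabolic_subgroup GL P -> parabolic_subgroup GL P3 -> theta J @` P3 = P3 ->
  Q = P3 `&` K -> is_subgroup Q ->
  double_flag J Q P x -> double_flag J Q P y -> GL h ->
  triple_act h (flag_emb J P3 x) = flag_emb J P3 y ->
  exists2 k, K k & double_act k x = y.
Proof.
move=> parP parP3 thetaP3 QE sQ; case: x y => [S1 T1] [S2 T2].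
move=> [[k1 Kk1 /= <-] [g1 ug1 /= <-]] [[k2 Kk2 /= <-] [g2 ug2 /= <-]] uh.
have [sP _ _ _] := parP; have [sP3 _ _ _] := parP3.
have [PGL P1 PM PV] := sP; have [P3GL P31 P3M P3V] := sP3.
have Q1 : Q 1%:M by case: sQ.
have QP3 : Q `<=` P3 by rewrite QE => z [].
have [uk1 fk1] := Kk1; have [uk2 fk2] := Kk2.
rewrite !(flag_embE _ uJ sP sP3 Q1 QP3) // /triple_act /= -!ltransM => -[e3 e1 e2].
pose h' := invmx k2 *m h *m k1.
pose g1' := invmx k1 *m g1; pose g2' := invmx k2 *m g2.
have ug1' : GL g1' by apply: GLM => //; exact: GLV.
have ug2' : GL g2' by apply: GLM => //; exact: GLV.
have hg : invmx g2' *m h' *m g1' = invmx g2 *m h *m g1.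
  rewrite /g2' /h' /g1' invmxM //; last exact: GLV.
  by rewrite invmxK !mulmxA mulmxK // mulmxK //.
have P3h' : P3 h'.
  by rewrite /h' -mulmxA; apply/(ltrans_eq sP3); [exact: GLM| |].
have Ph' : P (invmx g2' *m h' *m g1').
  by rewrite hg -mulmxA; apply/(ltrans_eq sP); [exact: GLM| |].
have thh : theta J h' = invmx k2 *m theta J h *m k1.
  rewrite /h' thetaM //; last by apply: GLM => //; exact: GLV.
  by rewrite thetaM ?thetaV ?fk1 ?fk2 //; exact: GLV.
have Pth' : P (invmx g2' *m theta J h' *m g1').
  have -> : invmx g2' *m theta J h' *m g1' = invmx g2 *m theta J h *m g1.
    rewrite thh /g2' /g1' invmxM //; last exact: GLV.
    by rewrite invmxK !mulmxA mulmxK // mulmxK.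
  have : ltrans (h *m theta J g1) (theta J @` P) (h *m theta J g1).
    exists 1%:M; last by rewrite mulmx1.
    by exists 1%:M => //; rewrite /theta invmx1 trmx1 mulmx1 mulmxV.
  rewrite e2 => -[_ [p Pp <-] /(congr1 (theta J))].
  rewrite -thetaM //; last exact: PGL.
  rewrite thetaK; last by apply: GLM => //; exact: PGL.
  rewrite thetaM ?thetaK //; last exact: theta_GL.
  by move=> eg; rewrite -mulmxA -eg mulKmx.
have [k [P3k Kk Pk]] := fixed_representative parP parP3 thetaP3 ug1' ug2' P3h' Ph' Pth'.
have [uk _] := Kk.
exists (k2 *m k *m invmx k1).
  apply: fixed_subgroupM => //; last exact: fixed_subgroupV.
  exact: fixed_subgroupM.
have uk2k : GL (k2 *m k) by exact: GLM.
rewrite /double_act /= -!ltransM; congr (_, _).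
  rewrite mulmxKV //; apply/(ltrans_eq sQ) => //.
  by rewrite mulKmx // QE.
apply/(ltrans_eq sP) => //; first by do ![apply: GLM => //]; exact: GLV.
move: Pk; rewrite /g2' /g1' invmxM //; last exact: GLV.
by rewrite invmxK !mulmxA.
Qed.

End Orbits.
Theorem theorem15p2 (R : realType) (n : nat) (J : 'M[R[i]]_n)
    (P Q P3 : set 'M[R[i]]_n) :
  (0 < n)%N ->
  J \in unitmx ->
  J *m J = 1%:M ->
  (forall g, GL g -> theta J (theta J g) = g) ->
  zariski_connected (fixed_subgroup J) ->
  parabolic_subgroup GL P ->
  parabolic_subgroup (fixed_subgroup J) Q ->
  parabolic_subgroup GL P3 ->
  theta J @` P3 = P3 ->
  Q = P3 `&` fixed_subgroup J ->
  let double_orbits := group_orbits (fixed_subgroup J) (@double_act _ n) (double_flag J Q P) in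
  let triple_orbits := group_orbits GL (@triple_act _ n) (triple_flag J P3 P) in
  [/\ set_fun double_orbits triple_orbits (orbit_map J P3),
      set_inj double_orbits (orbit_map J P3) &
      finite_set triple_orbits -> finite_set double_orbits].
Proof.
case: n J P Q P3 => // n J P Q P3 _ uJ _ thetaK _ parP parQ parP3 thetaP3 QE.
move=> double_orbits triple_orbits.
have [sP _ _ _] := parP; have [sP3 _ _ _] := parP3; have [sQ _ _ _] := parQ.
have PGL : P `<=` GL by case: sP.
have orbitE x : double_flag J Q P x ->
    orbit_map J P3 (group_orbit (fixed_subgroup J) (@double_act _ n.+1) x) =
    group_orbit GL (@triple_act _ n.+1) (flag_emb J P3 x).
  exact: orbit_map_orbit.
have orbit_fun : set_fun double_orbits triple_orbits (orbit_map J P3).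
  move=> _ [[S T] xF <-]; rewrite orbitE //; exists (flag_emb J P3 (S, T)) => //.
  case: xF => [[k [uk _] /= <-] [g ug /= <-]].
  rewrite flag_embE //; [|by case: sQ|by rewrite QE => z []].
  split; first by exists k.
  by split; [exists g|exists (theta J g) => //; exact: theta_GL].
have orbit_inj : set_inj double_orbits (orbit_map J P3).
  move=> O O'; rewrite !inE => -[x xF <-] [y yF <-]; rewrite !orbitE // => xy.
  have [h uh hE] : group_orbit GL (@triple_act _ n.+1)
      (flag_emb J P3 x) (flag_emb J P3 y).
    by rewrite xy; exists 1%:M; rewrite ?triple_act1 // /GL /= unitmx1.
  have [k Kk <-] :=
    double_orbit_of_triple uJ thetaK parP parP3 thetaP3 QE sQ xF yF uh hE.
  apply/seteqP; split=> _ [g Kg <-].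
    exists (g *m invmx k); last by rewrite -double_actM mulmxKV //; case: Kk.
    by apply: fixed_subgroupM => //; exact: fixed_subgroupV.
  by exists (g *m k); [exact: fixed_subgroupM|rewrite double_actM].
split=> // fin; rewrite -(eq_finite_set (inj_card_eq orbit_inj)).
by apply: sub_finite_set fin; exact/image_subP.
Qed.
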